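(* Let $k$ be a commutative ring with $\mathbb{Q}\subset k$ and $A$ a commutative $k$-algebra. Then the category of left (resp. right) HS-modules over $A/k$ coincides with the category of $A$-modules endowed with a left (resp. right) integrable connection over $A/k$. That is, the functor sending a left (resp. right) HS-module $(E,\Psi)$ to $(E,\nabla)$, where $\nabla$ is the left (resp. right) integrable connection given by $\Psi^1_{\{0,1\}}(\mathrm{Id}+\delta s)=1+\nabla(\delta)s$ for $\delta\in\mathrm{Der}_k(A)$, and which is the identity on the underlying maps, is an isomorphism of categories.
   Context: Throughout, $k$ is a commutative ring and $A$ a commutative $k$-algebra; $\mathbb{N}=\{0,1,2,\dots\}$; $\mathbf{s}=\{s_1,\dots,s_p\}$, $\mathbf{t}=\{t_1,\dots,t_q\}$ are sets of variables (for $p=1$ the variable is written $s$). Co-ideals and truncated series. $\mathbb{N}^p$ has the componentwise partial order. A co-ideal of $\mathbb{N}^p$ is a subset $\Delta$ such that $\alpha\in\Delta$, $\alpha'\le\alpha$ imply $\alpha'\in\Delta$. For an abelian group $M$ and a non-empty co-ideal $\Delta$, $M[[\mathbf{s}]]_\Delta$ is the quotient of $M[[\mathbf{s}]]$ by the series with $m_\alpha=0$ for all $\alpha\in\Delta$; its elements are written $\sum_{\alpha\in\Delta}m_\alpha\mathbf{s}^\alpha$. If $R$ is a ring, $R[[\mathbf{s}]]_\Delta$ is a ring (the variables are central), and $\mathcal{U}^p(R;\Delta)$ is the multiplicative group of $r\in R[[\mathbf{s}]]_\Delta$ with $r_0=1$. A $k$-algebra over $A$ is a not necessarily commutative $k$-algebra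 $R$ with a $k$-algebra map $\iota:A\to R$; elements of $A$ act on $R$ on both sides through $\iota$, and $a\in A$ is also written for $\iota(a)$. For an $A$-module $E$, $\mathrm{End}_k(E)$ and its opposite $\mathrm{End}_k(E)^{\mathrm{opp}}$ are $k$-algebras over $A$ via $a\mapsto(e\mapsto ae)$. Substitution maps. A substitution map $\varphi:A[[\mathbf{s}]]_\Delta\to A[[\mathbf{t}]]_\Omega$ (with $\Delta\subset\mathbb{N}^p$, $\Omega\subset\mathbb{N}^q$ non-empty co-ideals) is an $A$-algebra map such that each $\varphi(s_i)$ has zero constant term. For $r=\sum r_\alpha\mathbf{s}^\alpha\in R[[\mathbf{s}]]_\Delta$, $\varphi\bullet r:=\sum_\alpha\varphi(\mathbf{s}^\alpha)r_\alpha\in R[[\mathbf{t}]]_\Omega$. Hasse–Schmidt derivations. $\mathrm{HS}^p_k(A;\Delta)$ is the set of families $D=(D_\alpha)_{\alpha\in\Delta}$ of $k$-linear maps $D_\alpha:A\to A$ with $D_0=\mathrm{Id}$ and $D_\alpha(xy)=\sum_{\beta+\gamma=\alpha}D_\beta(x)D_\gamma(y)$. Identifying $D$ with $\sum_{\alpha\in\Delta}D_\alpha\mathbf{s}^\alpha$, it is a subgroup of $\mathcal{U}^p(\mathrm{End}_k(A);\Delta)$, and $\varphi\bullet D\in\mathrm{HS}^q_k(A;\Omega)$ for every substitution map $\varphi:A[[\mathbf{s}]]_\Delta\to A[[\mathbf{t}]]_\Omega$ with $\Delta\subset\mathbb{N}^p$, $\Omega\subset\mathbb{N}^q$ non-empty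 co-ideals (known). In particular $\mathrm{HS}^1_k(A;\{0,1\})=\{\mathrm{Id}+\delta s:\delta\in\mathrm{Der}_k(A)\}$. HS-structures. An HS-structure on a $k$-algebra $R$ over $A$ (over $A/k$) is a system of maps $\Psi^p_\Delta:\mathrm{HS}^p_k(A;\Delta)\to\mathcal{U}^p(R;\Delta)$, for $p\in\mathbb{N}$ and $\Delta\subset\mathbb{N}^p$ a non-empty co-ideal (for $p=0$ the groups are trivial), such that: (i) each $\Psi^p_\Delta$ is a group homomorphism; (ii) $\Psi^p_\Delta(D)\,a=\left(\sum_{\alpha\in\Delta}D_\alpha(a)\mathbf{s}^\alpha\right)\Psi^p_\Delta(D)$ for all $D\in\mathrm{HS}^p_k(A;\Delta)$, $a\in A$; (iii) $\Psi^q_\Omega(\varphi\bullet D)=\varphi\bullet\Psi^p_\Delta(D)$ for every substitution map $\varphi:A[[\mathbf{s}]]_\Delta\to A[[\mathbf{t}]]_\Omega$ and every $D\in\mathrm{HS}^p_k(A;\Delta)$. HS-modules. A left (resp. right) HS-module over $A/k$ is an $A$-module $E$ with an HS-structure on $\mathrm{End}_k(E)$ (resp. on $\mathrm{End}_k(E)^{\mathrm{opp}}$) over $A/k$. An HS-map $(E,\Phi)\to(F,\Psi)$ between left (resp. right) HS-modules is an $A$-linear map $f:E\to F$ such that $f\circ\Phi^p_\Delta(D)_\alpha=\Psi^p_\Delta(D)_\alpha\circ f$ for all $p$, all non-empty co-ideals $\Delta\subset\mathbb{N}^p$, all $\alpha\in\Delta$ and all $D\in\mathrm{HS}^p_k(A;\Delta)$,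 the coefficients being regarded as $k$-linear endomorphisms of $E$ and $F$. HS-maps are the morphisms of HS-modules. Integrable connections. A map $\nabla:\mathrm{Der}_k(A)\to R$ to a $k$-algebra $R$ over $A$ is LR-admissible if it is left $A$-linear, $\nabla(\delta)a=a\nabla(\delta)+\delta(a)1_R$, and $\nabla([\delta,\delta'])=[\nabla(\delta),\nabla(\delta')]$ for all $\delta,\delta'\in\mathrm{Der}_k(A)$, $a\in A$ (operations in $R$). A left (resp. right) integrable connection on an $A$-module $E$ over $A/k$ is an LR-admissible map $\nabla:\mathrm{Der}_k(A)\to\mathrm{End}_k(E)$ (resp. $\mathrm{Der}_k(A)\to\mathrm{End}_k(E)^{\mathrm{opp}}$). Morphisms $(E,\nabla)\to(F,\nabla')$ are the $A$-linear maps $f$ with $f\circ\nabla(\delta)=\nabla'(\delta)\circ f$ for all $\delta\in\mathrm{Der}_k(A)$. *)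

(* Defs.v *)
From HB Require Import structures.
From mathcomp Require Import all_boot all_order all_algebra.
From mathcomp Require Import boolp.
From mathcomp Require Import ssrcomplements mpoly.

Set Implicit Arguments.
Unset Strict Implicit.
Unset Printing Implicit Defensive.

Import GRing.Theory.
Local Open Scope ring_scope.

(* Sums over the decompositions a = b + c of a multi-index. *)
Definition convsum (M : nmodType) (p : nat)
    (F : 'X_{1..p} -> 'X_{1..p} -> M) (a : 'X_{1..p}) : M :=
  \sum_(bc : 'X_{1..p < (mdeg a).+1, (mdeg a).+1} | a == (bc.1 + bc.2)%MM)
     F bc.1 bc.2.

Section ConvSum.
Variables (M : nmodType) (p : nat).
Implicit Types (a b c : 'X_{1..p}) (F : 'X_{1..p} -> 'X_{1..p} -> M).

Lemma bsum_widen n m (G : 'X_{1..p} -> M) : (n <= m)%N ->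
  \sum_(b : 'X_{1..p < n}) G b = \sum_(b : 'X_{1..p < m} | (mdeg b < n)%N) G b.
Proof.
move=> le_nm; pose In : subFinType _ := 'X_{1..p < n}.
pose Im : subFinType _ := 'X_{1..p < m}.
by rewrite (big_sub_widen In Im xpredT G) //= => x /leq_trans; apply.
Qed.

Lemma bsum_bound n m (G : 'X_{1..p} -> M) :
  (forall b, (n <= mdeg b)%N -> G b = 0) -> (n <= m)%N ->
  \sum_(b : 'X_{1..p < m}) G b = \sum_(b : 'X_{1..p < n}) G b.
Proof.
move=> G0 le_nm; rewrite (bsum_widen _ le_nm).
by rewrite [RHS]big_rmcond //= => b; rewrite -leqNgt; apply: G0.
Qed.

Lemma lem_mdeg a b : (b <= a)%MM -> (mdeg b <= mdeg a)%N.
Proof. by move=> /submK <-; rewrite mdegD leq_addl. Qed.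

Lemma bsum_lem n m a (G : 'X_{1..p} -> M) : (mdeg a < n)%N -> (mdeg a < m)%N ->
  \sum_(b : 'X_{1..p < n} | (b <= a)%MM) G b
  = \sum_(b : 'X_{1..p < m} | (b <= a)%MM) G b.
Proof.
move=> lt1 lt2; rewrite [LHS]big_mkcond [RHS]big_mkcond /=.
pose H b := if (b <= a)%MM then G b else 0.
have H0 b : ((mdeg a).+1 <= mdeg b)%N -> H b = 0.
  by move=> lt_ab; rewrite /H; case: ifP => // /lem_mdeg; rewrite leqNgt lt_ab.
by rewrite (bsum_bound H0 lt1) (bsum_bound H0 lt2).
Qed.

Lemma pairsumE n F a : (mdeg a < n)%N ->
  \sum_(bc : 'X_{1..p < n, n} | a == (bc.1 + bc.2)%MM) F bc.1 bc.2
  = \sum_(b : 'X_{1..p < n} | (b <= a)%MM) F b (a - b)%MM.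
Proof.
move=> lt_a.
pose P (k1 k2 : 'X_{1..p < n}) := a == (k1 + k2)%MM.
pose Q (k : 'X_{1..p < n}) := (k <= a)%MM.
pose G (k1 k2 : 'X_{1..p < n}) := F k1 k2.
rewrite -(pair_big_dep xpredT P G) (bigID Q) /= addrC.
(rewrite big1 ?add0r {}/P {}/Q; first apply/eq_bigr)=> /= h1.
+ move=> le_h1; have pr : (mdeg (a - h1)%MM < n)%N.
    by rewrite (leq_ltn_trans _ lt_a) // mdegB.
  rewrite (big_pred1 (BMultinom pr)) //= => h2 /=.
  rewrite bmeqP /=; apply/eqP/eqP=> ->.
  * by rewrite addmC addmK.
  * by rewrite addmC submK //; apply/mnm_lepP.
+ rewrite negb_forall => /existsP /= [i Nle].
  rewrite big_pred0 //= => h2; apply/negbTE/eqP.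
  move/mnmP/(_ i); rewrite mnmDE=> eq; move: Nle.
  by rewrite eq leq_addr.
Qed.

Lemma convsumE n F a : (mdeg a < n)%N ->
  convsum F a = \sum_(b : 'X_{1..p < n} | (b <= a)%MM) F b (a - b)%MM.
Proof.
move=> lt_a; rewrite /convsum pairsumE //.
exact: (bsum_lem (fun b => F b (a - b)%MM)).
Qed.

Lemma convsum_pair n F a : (mdeg a < n)%N ->
  convsum F a
  = \sum_(bc : 'X_{1..p < n, n} | a == (bc.1 + bc.2)%MM) F bc.1 bc.2.
Proof. by move=> lt_a; rewrite pairsumE // (convsumE _ lt_a). Qed.

Lemma eq_convsum F G a :
  (forall b c, a = (b + c)%MM -> F b c = G b c) -> convsum F a = convsum G a.
Proof. by move=> FG; apply: eq_bigr => bc /eqP /FG. Qed.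

Lemma convsum0 F a :
  (forall b c, a = (b + c)%MM -> F b c = 0) -> convsum F a = 0.
Proof. by move=> FG; apply: big1 => bc /eqP /FG. Qed.

Lemma convsumD F G a :
  convsum (fun b c => F b c + G b c) a = convsum F a + convsum G a.
Proof. exact: big_split. Qed.

Lemma convsumC F a : convsum F a = convsum (fun b c => F c b) a.
Proof.
rewrite /convsum (reindex_onto (fun bc => (bc.2, bc.1))
  (fun bc => (bc.2, bc.1))) /=; last by case.
by apply: eq_bigl => -[b c] /=; rewrite eqxx andbT addmC.
Qed.

Lemma convsumA (F : 'X_{1..p} -> 'X_{1..p} -> 'X_{1..p} -> M) a :
  convsum (fun b c => convsum (fun d e => F b d e) c) a
  = convsum (fun b c => convsum (fun d e => F d e c) b) a.
Proof.
set n := (mdeg a).+1.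
have lt b : (mdeg (a - b)%MM < n)%N by rewrite ltnS mdegB.
rewrite (convsumE (n := n)) //.
under eq_bigr => b _ do rewrite (convsumE (n := n)) //.
rewrite [RHS]convsumC (convsumE (n := n)) //.
under [RHS]eq_bigr => b _ do rewrite (convsumE (n := n)) //.
transitivity (\sum_(b : 'X_{1..p < n} | (b <= a)%MM)
   \sum_(c : 'X_{1..p < n} | (c <= a - b)%MM) F b (a - b - c)%MM c).
  apply: eq_bigr => b _; rewrite -convsumE // convsumC (convsumE (n := n)) //.
rewrite (exchange_big_dep (fun c : 'X_{1..p < n} => (c <= a)%MM)) /=; last first.
  by move=> b c _ /lepm_trans; apply; apply: lem_subr.
apply: eq_bigr => c /mnm_lepP le_ca; apply: eq_big => b /=; last first.
  by move=> _; rewrite !submDA addmC.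
apply/andP/idP => [[/mnm_lepP h1 /mnm_lepP h2]|/mnm_lepP h].
  apply/mnm_lepP => i; move: (h1 i) (h2 i) (le_ca i); rewrite !mnmBE => {h1 h2}.
  by move=> h1 h2 h3; rewrite leq_subRL // addnC -leq_subRL.
split; apply/mnm_lepP => i; move: (h i) (le_ca i); rewrite !mnmBE.
  by move=> h1 _; apply: leq_trans h1 (leq_subr _ _).
move=> h1 h2; have h3 := leq_trans h1 (leq_subr _ _).
by rewrite leq_subRL // addnC -leq_subRL.
Qed.

Lemma convsum0l F a : (forall b c, b != 0%MM -> F b c = 0) ->
  convsum F a = F 0%MM a.
Proof.
move=> F0; rewrite (convsumE (n := (mdeg a).+1)) //.
have lt0 : (mdeg (0%MM : 'X_{1..p}) < (mdeg a).+1)%N by rewrite mdeg0.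
rewrite (bigD1 (BMultinom lt0)) /=; last by apply/mnm_lepP => i; rewrite mnm0E.
rewrite subm0 big1 ?addr0 // => b /andP[_ b0]; apply: F0.
by apply: contra b0 => /eqP b0; rewrite bmeqP /= b0.
Qed.

Lemma convsum0r F a : (forall b c, c != 0%MM -> F b c = 0) ->
  convsum F a = F a 0%MM.
Proof. by move=> F0; rewrite convsumC convsum0l // => b c; apply: F0. Qed.

Lemma convsum_0 F : convsum F 0%MM = F 0%MM 0%MM.
Proof.
rewrite (convsumE (n := 1)) ?mdeg0 //.
have lt0 : (mdeg (0%MM : 'X_{1..p}) < 1)%N by rewrite mdeg0.
rewrite (big_pred1 (BMultinom lt0)) => [|b]; first by rewrite subm0.
rewrite /= bmeqP /=; apply/idP/eqP => [/lem_mdeg|->].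
  by rewrite mdeg0 leqn0 mdeg_eq0 => /eqP.
exact: lepm_refl.
Qed.

Lemma convsum_1 F i : convsum F U_(i)%MM = F 0%MM U_(i)%MM + F U_(i)%MM 0%MM.
Proof.
rewrite (convsumE (n := 2)) ?mdeg1 //.
have lt0 : (mdeg (0%MM : 'X_{1..p}) < 2)%N by rewrite mdeg0.
have lt1 : (mdeg (U_(i)%MM : 'X_{1..p}) < 2)%N by rewrite mdeg1.
rewrite (bigD1 (BMultinom lt0)) /=; last by apply/mnm_lepP => j; rewrite mnm0E.
rewrite (bigD1 (BMultinom lt1)) /=; last first.
  by rewrite lepm_refl bmeqP /= mnm1_eq0.
have subUU : (U_(i) - U_(i) = 0)%MM by apply/mnmP => j; rewrite mnmBE subnn mnm0E.
rewrite subm0 subUU big1 ?addr0 // => b /andP[/andP[/mnm_lepP bU b0] b1].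
case/negP: b0; rewrite bmeqP /=; apply/eqP/mnmP => j; rewrite mnm0E; apply/eqP.
have := bU j; rewrite mnm1E; case: eqP => [<-|_]; last by rewrite leqn0.
rewrite leq_eqVlt ltnS leqn0 => /orP[/eqP bi|//].
case/negP: b1; rewrite bmeqP /=; apply/eqP/mnmP => j'; rewrite mnm1E.
case: eqP => [<-//|ij]; apply/eqP; rewrite -leqn0; have := bU j'.
by rewrite mnm1E; case: eqP.
Qed.

End ConvSum.

Lemma convsum_morph (M N : nmodType) p (h : M -> N) F (a : 'X_{1..p}) :
  h 0 = 0 -> {morph h : x y / x + y} ->
  h (convsum F a) = convsum (fun b c => h (F b c)) a.
Proof. by move=> h0 hD; rewrite /convsum (big_morph h hD h0). Qed.

(* Non-empty co-ideals; every subset is given by a boolean predicate, since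
   the logic is classical. *)
Record coideal (p : nat) := Coideal {
  coideal_pred :> {pred 'X_{1..p}};
  coideal_closed : forall a b : 'X_{1..p},
    a \in coideal_pred -> (b <= a)%MM -> b \in coideal_pred;
  coideal_nonempty : exists a, a \in coideal_pred }.

Lemma coideal0 p (Delta : coideal p) : 0%MM \in Delta.
Proof.
case: (coideal_nonempty Delta) => a aD; apply: coideal_closed aD _.
by apply/mnm_lepP => i; rewrite mnm0E.
Qed.

Lemma coideal_addl p (Delta : coideal p) a b :
  (a + b)%MM \in Delta -> a \in Delta.
Proof. by move=> abD; apply: coideal_closed abD _; apply: lem_addr. Qed.

Lemma coideal_addr p (Delta : coideal p) a b :
  (a + b)%MM \in Delta -> b \in Delta.
Proof. by rewrite addmC; apply: coideal_addl. Qed.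

(* An element of M[[s]]_Delta is represented by the only series of its class
   whose coefficients vanish outside Delta. *)
Record tseries (M : zmodType) (p : nat) (Delta : coideal p) := TSeries {
  tcoef :> 'X_{1..p} -> M;
  tcoefP : `[< forall a, a \notin Delta -> tcoef a = 0 >] }.

HB.instance Definition _ (M : zmodType) p (Delta : coideal p) :=
  [isSub of tseries M Delta for @tcoef M p Delta].
HB.instance Definition _ (M : zmodType) p (Delta : coideal p) :=
  [Choice of tseries M Delta by <:].

Section TSeriesZmod.
Variables (M : zmodType) (p : nat) (Delta : coideal p).
Implicit Types f g h : tseries M Delta.

Lemma tseriesP f g : (forall a, a \in Delta -> f a = g a) -> f = g.
Proof.
move=> fg; apply: val_inj; apply/funext => a /=.
have [/fg //|aD] := boolP (a \in Delta).
by case: f g {fg} => [f /asboolP f0] [g /asboolP g0] /=; rewrite f0 ?g0.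
Qed.

Lemma tcoef_out f a : a \notin Delta -> f a = 0.
Proof. by case: f => f /= /asboolP; apply. Qed.

Fact trunc_subproof (u : 'X_{1..p} -> M) :
  `[< forall a, a \notin Delta -> (if a \in Delta then u a else 0) = 0 >].
Proof. by apply/asboolP => a /negbTE ->. Qed.

(* The class of a series in the quotient. *)
Definition trunc (u : 'X_{1..p} -> M) : tseries M Delta :=
  TSeries (trunc_subproof u).

Lemma truncE u a : a \in Delta -> trunc u a = u a.
Proof. by move=> /= ->. Qed.

Definition tadd f g := trunc (fun a => f a + g a).
Definition topp f := trunc (fun a => - f a).
Definition tzero : tseries M Delta := trunc (fun=> 0).

Fact taddA : associative tadd.
Proof. by move=> f g h; apply: tseriesP => a aD; rewrite !truncE // addrA. Qed.
Fact taddC : commutative tadd.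
Proof. by move=> f g; apply: tseriesP => a aD; rewrite !truncE // addrC. Qed.
Fact tadd0 : left_id tzero tadd.
Proof. by move=> f; apply: tseriesP => a aD; rewrite !truncE // add0r. Qed.
Fact taddN : left_inverse tzero topp tadd.
Proof. by move=> f; apply: tseriesP => a aD; rewrite !truncE // addNr. Qed.

HB.instance Definition _ :=
  GRing.isZmodule.Build (tseries M Delta) taddA taddC tadd0 taddN.

Lemma tcoefD f g a : (f + g) a = f a + g a.
Proof.
have [aD|aD] := boolP (a \in Delta); first exact: truncE.
by rewrite !tcoef_out // addr0.
Qed.

Lemma tcoef0 a : (0 : tseries M Delta) a = 0.
Proof. by rewrite /= if_same. Qed.

Lemma tcoef_sum I (r : seq I) P (F : I -> tseries M Delta) a :
  (\sum_(i <- r | P i) F i) a = \sum_(i <- r | P i) F i a.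
Proof.
apply: (big_morph (fun f : tseries M Delta => f a)) => [f g|].
  exact: tcoefD.
exact: tcoef0.
Qed.

End TSeriesZmod.

Section TSeriesRing.
Variables (R : pzRingType) (p : nat) (Delta : coideal p).
Implicit Types f g h : tseries R Delta.

(* The monomial x s^a. *)
Definition tterm (x : R) (a : 'X_{1..p}) : tseries R Delta :=
  trunc Delta (fun b => if b == a then x else 0).
Definition tconst (x : R) : tseries R Delta := tterm x 0%MM.
Definition tmon (a : 'X_{1..p}) : tseries R Delta := tterm 1 a.
Definition tvar (i : 'I_p) : tseries R Delta := tmon U_(i)%MM.

Definition tmul f g : tseries R Delta :=
  trunc Delta (convsum (fun b c => f b * g c)).

Lemma tmulE f g a : a \in Delta -> tmul f g a = convsum (fun b c => f b * g c) a.
Proof. exact: truncE. Qed.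

Fact tmulA : associative tmul.
Proof.
move=> f g h; apply: tseriesP => a aD; rewrite !tmulE //.
transitivity (convsum (fun b c => convsum (fun d e => f b * (g d * h e)) c) a).
  apply: eq_convsum => b c ac; rewrite tmulE; last first.
    by apply: (@coideal_addr _ _ b); rewrite -ac.
  apply: (convsum_morph (h := fun x => f b * x)) => [|x y].
    by rewrite mulr0.
  by rewrite mulrDr.
rewrite convsumA; apply: eq_convsum => b c ac.
rewrite tmulE; last by apply: (@coideal_addl _ _ _ c); rewrite -ac.
rewrite (convsum_morph (h := fun x => x * h c)) ?mul0r => // [|x y].
  by apply: eq_convsum => d e _; rewrite mulrA.
by rewrite mulrDl.
Qed.

Lemma tconstE x a : tconst x a = if a == 0%MM then x else 0.
Proof.
by rewrite /=; case: ifP => //; case: eqP => // ->; rewrite coideal0.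
Qed.

Lemma tmul_constl x f a : tmul (tconst x) f a = x * f a.
Proof.
have [aD|aD] := boolP (a \in Delta); last by rewrite !tcoef_out // mulr0.
rewrite tmulE // convsum0l => [|b c b0]; first by rewrite tconstE eqxx.
by rewrite tconstE (negbTE b0) mul0r.
Qed.

Lemma tmul_constr x f a : tmul f (tconst x) a = f a * x.
Proof.
have [aD|aD] := boolP (a \in Delta); last by rewrite !tcoef_out // mul0r.
rewrite tmulE // convsum0r => [|b c b0]; first by rewrite tconstE eqxx.
by rewrite tconstE (negbTE b0) mulr0.
Qed.

Fact tmul1l : left_id (tconst 1) tmul.
Proof. by move=> f; apply: tseriesP => a aD; rewrite tmul_constl mul1r. Qed.
Fact tmul1r : right_id (tconst 1) tmul.
Proof. by move=> f; apply: tseriesP => a aD; rewrite tmul_constr mulr1. Qed.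
Fact tmulDl : left_distributive tmul +%R.
Proof.
move=> f g h; apply: tseriesP => a aD; rewrite tcoefD !tmulE // -convsumD.
by apply: eq_convsum => b c _; rewrite tcoefD mulrDl.
Qed.
Fact tmulDr : right_distributive tmul +%R.
Proof.
move=> f g h; apply: tseriesP => a aD; rewrite tcoefD !tmulE // -convsumD.
by apply: eq_convsum => b c _; rewrite tcoefD mulrDr.
Qed.

HB.instance Definition _ := GRing.Zmodule_isPzRing.Build (tseries R Delta)
  tmulA tmul1l tmul1r tmulDl tmulDr.

Lemma tcoefM f g a : a \in Delta ->
  (f * g) a = convsum (fun b c => f b * g c) a.
Proof. exact: tmulE. Qed.

Lemma tcoef1 a : (1 : tseries R Delta) a = if a == 0%MM then 1 else 0.
Proof. exact: tconstE. Qed.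

Lemma tcoefCM x f a : (tconst x * f) a = x * f a.
Proof. exact: tmul_constl. Qed.

Lemma tcoefMC x f a : (f * tconst x) a = f a * x.
Proof. exact: tmul_constr. Qed.

Lemma ttermM x a f d :
  (tterm x a * f) d = if (d \in Delta) && (a <= d)%MM then x * f (d - a)%MM else 0.
Proof.
have [dD|dD] := boolP (d \in Delta); last by rewrite tcoef_out.
rewrite andTb.
rewrite tcoefM // (convsumE (n := (mdeg d).+1)) //.
case: ifP => [le_ad|/negbT nle_ad]; last first.
  rewrite big1 // => b le_bd; rewrite truncE; last exact: coideal_closed le_bd.
  by case: eqP nle_ad => [<-|]; rewrite ?le_bd ?mul0r.
have la : (mdeg a < (mdeg d).+1)%N by rewrite ltnS lem_mdeg.
rewrite (bigD1 (BMultinom la)) //= big1 ?addr0 => [|b /andP[le_bd ba]].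
  by rewrite eqxx (coideal_closed dD).
rewrite (coideal_closed dD) //; case: eqP => [e|]; last by rewrite mul0r.
by case/negP: ba; rewrite bmeqP /= e.
Qed.

Lemma tmonM a f d :
  (tmon a * f) d = if (d \in Delta) && (a <= d)%MM then f (d - a)%MM else 0.
Proof. by rewrite ttermM mul1r. Qed.

Lemma tmonE a b : b \in Delta -> tmon a b = if b == a then 1 else 0.
Proof. exact: truncE. Qed.

Lemma tmonD a b : tmon (a + b)%MM = tmon a * tmon b.
Proof.
apply: tseriesP => d dD; rewrite tmonM (tmonE _ dD) dD andTb.
have [le_ad|nle_ad] := boolP (a <= d)%MM; last first.
  by have [e|//] := eqVneq d (a + b)%MM; rewrite e lem_addr in nle_ad.
rewrite tmonE; last exact: coideal_closed dD (lem_subr _ _).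
suff -> : (d == (a + b)%MM) = ((d - a)%MM == b) by [].
by apply/eqP/eqP => [->|<-]; rewrite addmC ?addmK ?submK.
Qed.

Lemma tmon0 : tmon 0%MM = 1. Proof. by []. Qed.

Lemma tcoefM0 f g : (f * g) 0%MM = f 0%MM * g 0%MM.
Proof. by rewrite tcoefM ?coideal0 // convsum_0. Qed.

End TSeriesRing.

(* The k-algebra structure of the commutative ring A is its structure map
   kA : k -> A; the library's algebras exclude the zero ring. *)
Section AlgebrasOver.
Variables (k A : comPzRingType) (kA : {rmorphism k -> A}).

Record algOver := AlgOver {
  alg_ring :> pzRingType;
  alg_iota : {rmorphism A -> alg_ring};
  alg_central : forall (c : k) (r : alg_ring),
    alg_iota (kA c) * r = r * alg_iota (kA c) }.

Definition klinear (E F : lmodType A) (f : E -> F) : Prop :=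
  (forall x y, f (x + y) = f x + f y)
  /\ (forall (c : k) x, f (kA c *: x) = kA c *: f x).

End AlgebrasOver.

Record kEnd (k A : comPzRingType) (kA : {rmorphism k -> A}) (E : lmodType A)
    := KEnd {
  kend_fun :> E -> E;
  kendP : `[< klinear kA kend_fun >] }.

HB.instance Definition _ (k A : comPzRingType) (kA : {rmorphism k -> A})
    (E : lmodType A) := [isSub of kEnd kA E for @kend_fun k A kA E].
HB.instance Definition _ (k A : comPzRingType) (kA : {rmorphism k -> A})
    (E : lmodType A) := [Choice of kEnd kA E by <:].

Section KEndRing.
Variables (k A : comPzRingType) (kA : {rmorphism k -> A}) (E : lmodType A).
Implicit Types f g h : kEnd kA E.

Lemma kend_eqP f g : (forall x, f x = g x) -> f = g.
Proof. by move=> fg; apply: val_inj; apply/funext. Qed.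

Lemma kendD f x y : f (x + y) = f x + f y.
Proof. by have /asboolP [] := kendP f. Qed.

Lemma kendZ f c x : f (kA c *: x) = kA c *: f x.
Proof. by have /asboolP [] := kendP f. Qed.

Lemma kend0 f : f 0 = 0.
Proof. by apply: (@addrI _ (f 0)); rewrite -kendD !addr0. Qed.

Lemma kendN f x : f (- x) = - f x.
Proof. by apply: (@addrI _ (f x)); rewrite -kendD !subrr kend0. Qed.

Fact kend_add_subproof f g : `[< klinear kA (fun x => f x + g x) >].
Proof.
apply/asboolP; split=> [x y|c x]; first by rewrite !kendD addrACA.
by rewrite !kendZ scalerDr.
Qed.
Definition kend_add f g := KEnd (kend_add_subproof f g).

Fact kend_opp_subproof f : `[< klinear kA (fun x => - f x) >].
Proof.
apply/asboolP; split=> [x y|c x]; first by rewrite kendD opprD.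
by rewrite kendZ scalerN.
Qed.
Definition kend_opp f := KEnd (kend_opp_subproof f).

Fact kend_zero_subproof : `[< klinear kA (fun _ : E => 0 : E) >].
Proof. by apply/asboolP; split=> [x y|c x]; rewrite ?addr0 ?scaler0. Qed.
Definition kend_zero := KEnd kend_zero_subproof.

Fact kend_one_subproof : `[< klinear kA (fun x : E => x) >].
Proof. exact/asboolP. Qed.
Definition kend_one := KEnd kend_one_subproof.

Fact kend_mul_subproof f g : `[< klinear kA (fun x => f (g x)) >].
Proof. by apply/asboolP; split=> [x y|c x]; rewrite ?kendD ?kendZ. Qed.
Definition kend_mul f g := KEnd (kend_mul_subproof f g).

Fact kend_addA : associative kend_add.
Proof. by move=> f g h; apply: kend_eqP => x /=; rewrite addrA. Qed.
Fact kend_addC : commutative kend_add.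
Proof. by move=> f g; apply: kend_eqP => x /=; rewrite addrC. Qed.
Fact kend_add0 : left_id kend_zero kend_add.
Proof. by move=> f; apply: kend_eqP => x /=; rewrite add0r. Qed.
Fact kend_addN : left_inverse kend_zero kend_opp kend_add.
Proof. by move=> f; apply: kend_eqP => x /=; rewrite addNr. Qed.
HB.instance Definition _ := GRing.isZmodule.Build (kEnd kA E)
  kend_addA kend_addC kend_add0 kend_addN.

Fact kend_mulA : associative kend_mul.
Proof. by move=> f g h; apply: kend_eqP. Qed.
Fact kend_mul1l : left_id kend_one kend_mul.
Proof. by move=> f; apply: kend_eqP => x. Qed.
Fact kend_mul1r : right_id kend_one kend_mul.
Proof. by move=> f; apply: kend_eqP => x. Qed.
Fact kend_mulDl : left_distributive kend_mul +%R.
Proof. by move=> f g h; apply: kend_eqP => x. Qed.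
Fact kend_mulDr : right_distributive kend_mul +%R.
Proof. by move=> f g h; apply: kend_eqP => x; apply: kendD. Qed.
HB.instance Definition _ := GRing.Zmodule_isPzRing.Build (kEnd kA E)
  kend_mulA kend_mul1l kend_mul1r kend_mulDl kend_mulDr.

Fact kend_scal_subproof (a : A) : `[< klinear kA (fun x : E => a *: x) >].
Proof.
apply/asboolP; split=> [x y|c x]; first by rewrite scalerDr.
by rewrite !scalerA mulrC.
Qed.
Definition kend_scal (a : A) : kEnd kA E := KEnd (kend_scal_subproof a).
Definition kend_scal_opp (a : A) : (kEnd kA E)^c := kend_scal a.

Fact kend_scalB : zmod_morphism kend_scal.
Proof. by move=> a b; apply: kend_eqP => x /=; rewrite scalerBl. Qed.
HB.instance Definition _ :=
  GRing.isZmodMorphism.Build A (kEnd kA E) kend_scal kend_scalB.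

Fact kend_scalM : monoid_morphism kend_scal.
Proof.
split; first by apply: kend_eqP => x /=; rewrite scale1r.
by move=> a b; apply: kend_eqP => x /=; rewrite scalerA.
Qed.
HB.instance Definition _ :=
  GRing.isMonoidMorphism.Build A (kEnd kA E) kend_scal kend_scalM.

Fact kend_scal_oppB : zmod_morphism kend_scal_opp.
Proof. exact: kend_scalB. Qed.
HB.instance Definition _ :=
  GRing.isZmodMorphism.Build A (kEnd kA E)^c kend_scal_opp kend_scal_oppB.

Fact kend_scal_oppM : monoid_morphism kend_scal_opp.
Proof.
split; first by apply: kend_eqP => x /=; rewrite scale1r.
by move=> a b; apply: kend_eqP => x /=; rewrite mulrC scalerA.
Qed.
HB.instance Definition _ :=
  GRing.isMonoidMorphism.Build A (kEnd kA E)^c kend_scal_opp kend_scal_oppM.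

Fact kend_central c (f : kEnd kA E) :
  (kend_scal : {rmorphism A -> kEnd kA E}) (kA c) * f = f * kend_scal (kA c).
Proof. by apply: kend_eqP => x; rewrite /= [LHS]/= -kendZ. Qed.

Fact kend_central_opp c (f : (kEnd kA E)^c) :
  (kend_scal_opp : {rmorphism A -> (kEnd kA E)^c}) (kA c) * f
  = f * kend_scal_opp (kA c).
Proof. by apply: kend_eqP => x; apply: (kendZ (f : kEnd kA E)). Qed.

Definition kEndAlg : algOver kA := AlgOver kend_central.
Definition kEndOppAlg : algOver kA := AlgOver kend_central_opp.

End KEndRing.

Arguments tcoef : simpl never.

(* A morphism of A-algebras is a ring morphism that commutes with the structure
   maps, which here send x to the constant series x. *)
Record substmap (A : comPzRingType) (p q : nat)
    (Delta : coideal p) (Omega : coideal q) := SubstMap {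
  subst_fun :> {rmorphism tseries A Delta -> tseries A Omega};
  subst_const : forall x : A, subst_fun (tconst Delta x) = tconst Omega x;
  subst_var0 : forall i : 'I_p, subst_fun (tvar A Delta i) 0%MM = 0 }.

Section SubstOrder.
Variables (A : comPzRingType) (p q : nat).
Variables (Delta : coideal p) (Omega : coideal q).
Variable phi : substmap A Delta Omega.

Lemma tseries_div (f : tseries A Delta) : f 0%MM = 0 ->
  exists2 g : 'I_p -> tseries A Delta,
    f = \sum_i tvar A Delta i * g i &
    forall i a, g i a = 0 \/ g i a = f (a + U_(i))%MM.
Proof.
move=> f0.
pose P (i : 'I_p) (a : 'X_{1..p}) :=
  [forall j : 'I_p, (j < i)%N ==> (a j == 0%N)].
exists (fun i => trunc Delta (fun a => if P i a then f (a + U_(i))%MM else 0));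
  last first.
  move=> i a; rewrite /trunc /tcoef.
  by case: (a \in Delta); case: (P i a); [right|left|left|left].
apply: tseriesP => d dD; rewrite tcoef_sum.
under eq_bigr => i _ do rewrite tmonM dD andTb.
have dUD i : (d - U_(i))%MM \in Delta by apply: coideal_closed dD (lem_subr _ _).
have leU i : (U_(i) <= d)%MM = (0 < d i)%N.
  apply/mnm_lepP/idP => [/(_ i)|di j]; first by rewrite mnm1E eqxx.
  by rewrite mnm1E; case: eqP => // <-.
case: (pickP (fun i => 0 < d i)%N) => [i0 di0|d0]; last first.
  rewrite big1 => [|i _]; last by rewrite leU d0.
  suff -> : d = 0%MM by [].
  by apply/mnmP => i; rewrite mnm0E; apply/eqP; rewrite -leqn0 leqNgt d0.
case: (@arg_minnP _ i0 (fun i => 0 < d i)%N (fun i : 'I_p => nat_of_ord i) di0) => i di imin.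
rewrite (bigD1 i) //= leU di truncE // ifT; last first.
  apply/forallP => j; apply/implyP => lt_ji; rewrite mnmBE.
  have: ~~ (0 < d j)%N by apply: contraL lt_ji => /imin; rewrite -leqNgt.
  by rewrite -leqNgt leqn0 => /eqP ->.
rewrite submK ?leU // big1 ?addr0 // => j ji.
rewrite leU; case: ifP => // dj; rewrite truncE // ifF //.
apply/negbTE; rewrite negb_forall; apply/existsP; exists i.
rewrite negb_imply mnmBE mnm1E (negbTE ji) subn0 -lt0n di andbT.
by rewrite ltn_neqAle imin // andbT eq_sym; apply: contra ji => /eqP/val_inj ->.
Qed.

Lemma subst_order n (f : tseries A Delta) :
  (forall a, (mdeg a < n)%N -> f a = 0) ->
  forall w, (mdeg w < n)%N -> phi f w = 0.
Proof.
elim: n f => // n IHn f f_ord w lt_w.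
have [wO|/tcoef_out-> //] := boolP (w \in Omega).
have f0 : f 0%MM = 0 by rewrite f_ord // mdeg0.
have [g fE gE] := tseries_div f0.
rewrite fE rmorph_sum tcoef_sum big1 // => i _; rewrite rmorphM tcoefM //.
apply: convsum0 => b c wE.
have [->|b0] := eqVneq b 0%MM; first by rewrite subst_var0 mul0r.
have -> : phi (g i) c = 0; last by rewrite mulr0.
apply: IHn => [a lt_a|].
  case: (gE i a) => [//|->]; apply: f_ord.
  by rewrite mdegD mdeg1 addn1.
rewrite -ltnS (leq_ltn_trans _ lt_w) // wE mdegD -addn1 addnC leq_add2r.
by rewrite lt0n mdeg_eq0.
Qed.

Lemma subst_tmon_order a w : (mdeg w < mdeg a)%N -> phi (tmon A Delta a) w = 0.
Proof.
move=> lt_wa; apply: (@subst_order (mdeg a)) => // b lt_ba.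
have [bD|/tcoef_out-> //] := boolP (b \in Delta).
by rewrite tmonE //; case: eqP lt_ba => // ->; rewrite ltnn.
Qed.

Lemma substE N f w : (mdeg w < N)%N ->
  phi f w = \sum_(a : 'X_{1..p < N}) phi (tmon A Delta a) w * f a.
Proof.
move=> lt_w.
pose h := \sum_(a : 'X_{1..p < N}) tterm Delta (f a) a.
have phih : phi h w = \sum_(a : 'X_{1..p < N}) phi (tmon A Delta a) w * f a.
  rewrite rmorph_sum tcoef_sum; apply: eq_bigr => a _.
  have -> : tterm Delta (f a) a = tconst Delta (f a) * tmon A Delta a.
    apply: tseriesP => b bD; rewrite tcoefCM tmonE // truncE //.
    by case: ifP; rewrite ?mulr1 ?mulr0.
  by rewrite rmorphM subst_const tcoefCM mulrC.
rewrite -phih; apply/eqP; rewrite -subr_eq0.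
have -> : phi f w - phi h w = phi (f - h) w.
  apply/eqP; rewrite subr_eq -tcoefD -rmorphD subrK //.
apply/eqP; apply: (@subst_order N) => // a lt_a.
have [aD|/tcoef_out-> //] := boolP (a \in Delta).
suff e : h a = f a by apply: (addIr (h a)); rewrite -tcoefD subrK e add0r.
rewrite tcoef_sum (bigD1 (BMultinom lt_a)) //= truncE // eqxx.
rewrite big1 ?addr0 // => b ba; rewrite truncE // ifF //.
by apply: contraNF ba => /eqP e; rewrite bmeqP /= e.
Qed.

End SubstOrder.

Section SubstAction.
Variables (k A : comPzRingType) (kA : {rmorphism k -> A}) (R : algOver kA).
Variables (p q : nat) (Delta : coideal p) (Omega : coideal q).
Variable phi : substmap A Delta Omega.

(* The coefficient of t^w in phi(s^a) vanishes as soon as |a| > |w|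
   (subst_tmon_order), so that the sum over all a in Delta reduces to the
   following finite one. *)
Definition subst_act (r : tseries R Delta) : tseries R Omega :=
  trunc Omega (fun w => \sum_(a : 'X_{1..p < (mdeg w).+1} | val a \in Delta)
    alg_iota R (phi (tmon A Delta a) w) * r a).

Lemma subst_actE N (r : tseries R Delta) w : w \in Omega -> (mdeg w < N)%N ->
  subst_act r w
  = \sum_(a : 'X_{1..p < N}) alg_iota R (phi (tmon A Delta a) w) * r a.
Proof.
move=> wO lt_w; rewrite truncE // big_rmcond => [|a aD]; last first.
  by rewrite (tcoef_out r aD) mulr0.
rewrite -(@bsum_bound _ _ (mdeg w).+1 N
  (fun a => alg_iota R (phi (tmon A Delta a) w) * r a)) // => b lt_wb.
by rewrite subst_tmon_order // rmorph0 mul0r.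
Qed.

End SubstAction.

(* The image in R[[s]]_Delta of a series with coefficients in A. *)
Definition tlift (k A : comPzRingType) (kA : {rmorphism k -> A}) (R : algOver kA)
    (p : nat) (Delta : coideal p) (f : tseries A Delta) : tseries R Delta :=
  trunc Delta (fun a => alg_iota R (f a)).

Section SubstActionTheory.
Variables (k A : comPzRingType) (kA : {rmorphism k -> A}) (R : algOver kA).
Variables (p q : nat) (Delta : coideal p) (Omega : coideal q).
Variable phi : substmap A Delta Omega.

Lemma tliftE (f : tseries A Delta) a : tlift R f a = alg_iota R (f a).
Proof.
have [aD|aD] := boolP (a \in Delta); first exact: truncE.
by rewrite !tcoef_out // rmorph0.
Qed.

Lemma subst_act_constr (r : tseries R Delta) (x : R) :
  subst_act phi (r * tconst Delta x) = subst_act phi r * tconst Omega x.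
Proof.
apply: tseriesP => w wO; rewrite tcoefMC !(subst_actE _ _ wO (ltnSn _)).
by rewrite big_distrl /=; apply: eq_bigr => a _; rewrite tcoefMC mulrA.
Qed.

End SubstActionTheory.

Lemma subst_act_liftl (k A : comPzRingType) (kA : {rmorphism k -> A})
    (R : algOver kA) (p q : nat) (Delta : coideal p) (Omega : coideal q)
    (phi : substmap A Delta Omega) (f : tseries A Delta) (r : tseries R Delta) :
  subst_act phi (tlift R f * r) = tlift R (phi f) * subst_act phi r.
Proof.
apply: tseriesP => w wO; rewrite tcoefM //.
pose N := (mdeg w + mdeg w).+1.
have lt_w : (mdeg w < N)%N by rewrite ltnS leq_addr.
pose X a := alg_iota R (phi (tmon A Delta a) w).
pose G b c := X (b + c)%MM * (alg_iota R (f b) * r c).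
have X0 a : (mdeg w < mdeg a)%N -> X a = 0.
  by move=> lt_wa; rewrite /X subst_tmon_order // rmorph0.
rewrite (subst_actE _ _ wO lt_w).
transitivity (\sum_(a : 'X_{1..p < N}) 
   \sum_(bc : 'X_{1..p < N, N} | val a == (bc.1 + bc.2)%MM) G bc.1 bc.2).
  apply: eq_bigr => a _.
  have [aD|aD] := boolP (val a \in Delta); last first.
    rewrite (tcoef_out _ aD) mulr0 big1 // => bc /eqP e; rewrite /G -e /X.
    have -> : tmon A Delta (val a) = 0.
      apply: tseriesP => b bD; rewrite tmonE // tcoef0.
      by case: eqP => // eb; rewrite -eb bD in aD.
    by rewrite rmorph0 tcoef0 rmorph0 mul0r.
  rewrite tcoefM // (convsum_pair _ (bmdeg a)) big_distrr /=.
  by apply: eq_bigr => bc /eqP e; rewrite /G -e tliftE.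
rewrite (exchange_big_dep xpredT) //=.
transitivity (\sum_(bc : 'X_{1..p < N, N}) G bc.1 bc.2).
  apply: eq_bigr => bc _.
  have [lt|ge] := ltnP (mdeg (bc.1 + bc.2)%MM) N.
    by rewrite (big_pred1 (BMultinom lt)) // => a; rewrite bmeqP.
  rewrite big1 // => [|a _]; rewrite /G X0 ?mul0r //; exact: leq_trans lt_w ge.
rewrite -(pair_bigA _ (fun b c : 'X_{1..p < N} => G b c)) /=.
transitivity (\sum_(b : 'X_{1..p < N}) \sum_(c : 'X_{1..p < N})
  convsum (fun v u => alg_iota R (phi (tmon A Delta b) v)
     * alg_iota R (phi (tmon A Delta c) u) * (alg_iota R (f b) * r c)) w).
  apply: eq_bigr => b _; apply: eq_bigr => c _; rewrite /G /X tmonD rmorphM.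
  rewrite tcoefM // (convsum_morph (h := alg_iota R)); last first.
    - exact: rmorphD.
    - exact: rmorph0.
  rewrite (convsum_morph (h := fun x => x * _)) ?mul0r //; last first.
    by move=> x y; rewrite mulrDl.
  by apply: eq_convsum => v u _; rewrite rmorphM.
rewrite /convsum.
under eq_bigr => b _ do rewrite exchange_big.
rewrite exchange_big /=; apply: eq_bigr => -[v u] /= /eqP wE.
have vO : val v \in Omega by apply: (@coideal_addl _ _ _ u); rewrite -wE.
have uO : val u \in Omega by apply: (@coideal_addr _ _ v); rewrite -wE.
have lt_v : (mdeg v < N)%N.
  by apply: leq_ltn_trans lt_w; rewrite -ltnS bmdeg.
have lt_u : (mdeg u < N)%N.
  by apply: leq_ltn_trans lt_w; rewrite -ltnS bmdeg.
rewrite tliftE (substE _ _ lt_v) (subst_actE _ _ uO lt_u) rmorph_sum.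
rewrite big_distrl /=; apply: eq_bigr => b _.
rewrite big_distrr /=; apply: eq_bigr => c _.
by rewrite rmorphM !mulrA; congr (_ * _); rewrite -!rmorphM mulrAC.
Qed.

Section HasseSchmidt.
Variables (k A : comPzRingType) (kA : {rmorphism k -> A}).
Local Notation EndA := (kEndAlg kA A^o).

Definition leibniz p (Delta : coideal p) (D : tseries (kEnd kA A^o) Delta) :=
  forall a, a \in Delta -> forall x y : A,
    D a (x * y) = convsum (fun b c => (D b x : A) * (D c y : A)) a :> A.

(* The family (D_a)_(a in Delta), identified with the series of the D_a s^a. *)
Record hsder p (Delta : coideal p) := HSDer {
  hs_series :> tseries (kEnd kA A^o) Delta;
  hs_coef0 : hs_series 0%MM = 1;
  hs_leibniz : leibniz hs_series }.

(* The series with coefficients D_a(x). *)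
Definition hs_app p (Delta : coideal p) (D : tseries (kEnd kA A^o) Delta)
  (x : A) : tseries A Delta := trunc Delta (fun a => D a x : A).

Lemma hs_appE p (Delta : coideal p) (D : tseries (kEnd kA A^o) Delta) x a :
  hs_app D x a = D a x.
Proof.
have [aD|aD] := boolP (a \in Delta); first exact: truncE.
by rewrite !tcoef_out.
Qed.

Lemma convsum_kend p (F : 'X_{1..p} -> 'X_{1..p} -> kEnd kA A^o) a (x : A) :
  convsum F a x = convsum (fun b c => F b c x : A) a.
Proof. exact: (convsum_morph (h := fun f : kEnd kA A^o => f x : A)). Qed.

Lemma leibnizP p (Delta : coideal p) (D : tseries (kEnd kA A^o) Delta) :
  leibniz D <-> forall x : A,
    (D : tseries EndA Delta) * tconst Delta (alg_iota EndA x)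
    = tlift EndA (hs_app D x) * (D : tseries EndA Delta).
Proof.
split=> [DL x|DL a aD x y].
  apply: tseriesP => a aD; apply: kend_eqP => y.
  rewrite tcoefMC tcoefM //= [LHS](DL a aD) convsum_kend.
  by apply: eq_convsum => b c _; rewrite tliftE hs_appE.
have /(congr1 (fun f => tcoef f a)) := DL x.
rewrite tcoefMC tcoefM // => /(congr1 (fun f : kEnd kA A^o => f y : A)) /= ->.
rewrite convsum_kend; apply: eq_convsum => b c _.
by rewrite tliftE hs_appE.
Qed.

Lemma tlift_hs_app_mul p (Delta : coideal p)
    (D E : tseries (kEnd kA A^o) Delta) x : leibniz D ->
  (D : tseries EndA Delta) * tlift EndA (hs_app E x)
  = tlift EndA (hs_app (D * E) x) * (D : tseries EndA Delta).
Proof.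
move=> /leibnizP DL; apply: tseriesP => a aD; rewrite !tcoefM //.
transitivity (convsum (fun b c => convsum (fun d e =>
   alg_iota EndA (D d (E c x) : A) * D e) b) a).
  apply: eq_convsum => b c e.
  have bD : b \in Delta by apply: (@coideal_addl _ _ _ c); rewrite -e.
  rewrite tliftE hs_appE.
  have /(congr1 (fun f => tcoef f b)) := DL (E c x : A).
  rewrite tcoefMC tcoefM // => ->; apply: eq_convsum => u v _.
  by rewrite tliftE hs_appE.
pose G d c e := alg_iota EndA (D d (E c x) : A) * D e.
rewrite -(convsumA (fun d e c => G d c e)).
transitivity (convsum (fun d y => convsum (fun c e => G d c e) y) a).
  by apply: eq_convsum => d y _; rewrite convsumC.
rewrite (convsumA G); apply: eq_convsum => b c e.
have bD : b \in Delta by apply: (@coideal_addl _ _ _ c); rewrite -e.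
rewrite tliftE hs_appE tcoefM // convsum_kend.
rewrite (convsum_morph (h := fun z : A => alg_iota EndA z * D c)) //.
  by rewrite rmorph0 mul0r.
by move=> u v; rewrite rmorphD mulrDl.
Qed.

Fact hs_mul_coef0 p (Delta : coideal p) (D E : hsder Delta) :
  (hs_series D * hs_series E) 0%MM = 1.
Proof. by rewrite tcoefM0 !hs_coef0 mulr1. Qed.

Fact hs_mul_leibniz p (Delta : coideal p) (D E : hsder Delta) :
  leibniz (hs_series D * hs_series E).
Proof.
have /leibnizP EL := @hs_leibniz _ _ E.
apply/leibnizP => x; rewrite -mulrA [X in _ * X]EL mulrA.
by rewrite (tlift_hs_app_mul _ _ (@hs_leibniz _ _ D)) mulrA.
Qed.

Definition hs_mul p (Delta : coideal p) (D E : hsder Delta) : hsder Delta :=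
  HSDer (hs_mul_coef0 D E) (@hs_mul_leibniz _ _ D E).

Section HSSubst.
Variables (p q : nat) (Delta : coideal p) (Omega : coideal q).
Variables (phi : substmap A Delta Omega) (D : hsder Delta).

Fact hs_subst_coef0 :
  subst_act phi (hs_series D : tseries EndA Delta) 0%MM = 1.
Proof.
have lt0 : (mdeg (0%MM : 'X_{1..q}) < 1)%N by rewrite mdeg0.
have lt0' : (mdeg (0%MM : 'X_{1..p}) < 1)%N by rewrite mdeg0.
rewrite (subst_actE _ _ (coideal0 Omega) lt0).
rewrite (big_pred1 (BMultinom lt0')) /= => [|b]; last first.
  by rewrite /= bmeqP /= -mdeg_eq0 -leqn0 -ltnS bmdeg.
by rewrite tmon0 rmorph1 tcoef1 eqxx rmorph1 hs_coef0 mulr1.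
Qed.

Lemma hs_app_subst x :
  hs_app (subst_act phi (hs_series D : tseries EndA Delta)) x
  = phi (hs_app D x).
Proof.
apply: tseriesP => w wO; rewrite hs_appE (subst_actE _ _ wO (ltnSn _)).
rewrite (substE _ _ (ltnSn _)).
rewrite (big_morph (fun f : kEnd kA A^o => f x : A) (id1 := 0) (op1 := +%R)) //.
by apply: eq_bigr => a _; rewrite hs_appE.
Qed.

Fact hs_subst_leibniz :
  leibniz (subst_act phi (hs_series D : tseries EndA Delta)).
Proof.
apply/leibnizP => x; have /leibnizP DL := @hs_leibniz _ _ D.
by rewrite -subst_act_constr DL subst_act_liftl hs_app_subst.
Qed.

Definition hs_subst : hsder Omega := HSDer hs_subst_coef0 hs_subst_leibniz.

End HSSubst.

(* Products of series over R are convolutions of products in R: when R is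
   End_k(E)^opp, the fields below are all relative to the opposite product. *)
Record hsStructure (R : algOver kA) := HSStructure {
  hs_map : forall (p : nat) (Delta : coideal p), hsder Delta -> tseries R Delta;
  hs_map_coef0 : forall p (Delta : coideal p) (D : hsder Delta),
    hs_map D 0%MM = 1;
  hs_map_mul : forall p (Delta : coideal p) (D E : hsder Delta),
    hs_map (hs_mul D E) = hs_map D * hs_map E;
  hs_map_comm : forall p (Delta : coideal p) (D : hsder Delta) (x : A),
    hs_map D * tconst Delta (alg_iota R x) = tlift R (hs_app D x) * hs_map D;
  hs_map_subst : forall p q (Delta : coideal p) (Omega : coideal q)
      (phi : substmap A Delta Omega) (D : hsder Delta),
    hs_map (hs_subst phi D) = subst_act phi (hs_map D) }.

End HasseSchmidt.

Record der (k A : comPzRingType) (kA : {rmorphism k -> A}) := Der {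
  der_end :> kEnd kA A^o;
  derP : `[< forall x y : A,
             der_end (x * y) = x * (der_end y : A) + (der_end x : A) * y >] }.


Section Derivations.
Variables (k A : comPzRingType) (kA : {rmorphism k -> A}).
Implicit Types d e : der kA.

HB.instance Definition _ := [isSub of der kA for @der_end k A kA].
HB.instance Definition _ := [Choice of der kA by <:].

Lemma derM d (x y : A) : d (x * y) = x * (d y : A) + (d x : A) * y.
Proof. by have /asboolP := derP d; apply. Qed.

Lemma der_eqP d e : (forall x, d x = e x) -> d = e.
Proof. by move=> de; apply: val_inj; apply: kend_eqP. Qed.

Fact der_add_subproof d e : `[< forall x y : A,
  (der_end d + der_end e) (x * y)
  = x * ((der_end d + der_end e) y : A) + ((der_end d + der_end e) x : A) * y >].
Proof. by apply/asboolP => x y /=; rewrite !derM mulrDl mulrDr addrACA. Qed.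
Definition der_add d e : der kA := Der (der_add_subproof d e).

Fact der_opp_subproof d : `[< forall x y : A,
  (- der_end d) (x * y)
  = x * ((- der_end d) y : A) + ((- der_end d) x : A) * y >].
Proof. by apply/asboolP => x y /=; rewrite !derM mulrN mulNr opprD. Qed.
Definition der_opp d : der kA := Der (der_opp_subproof d).

Fact der_zero_subproof : `[< forall x y : A,
  (0 : kEnd kA A^o) (x * y)
  = x * ((0 : kEnd kA A^o) y : A) + ((0 : kEnd kA A^o) x : A) * y >].
Proof. by apply/asboolP => x y /=; rewrite mulr0 mul0r addr0. Qed.
Definition der_zero : der kA := Der der_zero_subproof.

Fact der_addA : associative der_add.
Proof. by move=> d e f; apply: der_eqP => x /=; rewrite addrA. Qed.
Fact der_addC : commutative der_add.
Proof. by move=> d e; apply: der_eqP => x /=; rewrite addrC. Qed.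
Fact der_add0 : left_id der_zero der_add.
Proof. by move=> d; apply: der_eqP => x /=; rewrite add0r. Qed.
Fact der_addN : left_inverse der_zero der_opp der_add.
Proof. by move=> d; apply: der_eqP => x /=; rewrite addNr. Qed.
HB.instance Definition _ := GRing.isZmodule.Build (der kA)
  der_addA der_addC der_add0 der_addN.

Fact der_scale_subproof (a : A) d : `[< forall x y : A,
  (kend_scal kA A^o a * der_end d) (x * y)
  = x * ((kend_scal kA A^o a * der_end d) y : A)
    + ((kend_scal kA A^o a * der_end d) x : A) * y >].
Proof.
apply/asboolP => x y; rewrite /= derM scalerDr.
by congr (_ + _); rewrite /GRing.scale /= ?mulrA // [a * x]mulrC.
Qed.
Definition der_scale (a : A) d : der kA := Der (der_scale_subproof a d).

Fact der_scaleA a b d : der_scale a (der_scale b d) = der_scale (a * b) d.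
Proof. by apply: der_eqP => x; rewrite /= scalerA. Qed.
Fact der_scale1 : left_id 1 der_scale.
Proof. by move=> d; apply: der_eqP => x; rewrite /= scale1r. Qed.
Fact der_scaleDr : right_distributive der_scale +%R.
Proof. by move=> a d e; apply: der_eqP => x; rewrite /= scalerDr. Qed.
Fact der_scaleDl d : {morph der_scale^~ d : a b / a + b}.
Proof. by move=> a b; apply: der_eqP => x; rewrite /= scalerDl. Qed.
HB.instance Definition _ := GRing.Zmodule_isLmodule.Build A (der kA)
  der_scaleA der_scale1 der_scaleDr der_scaleDl.

Fact der_bracket_subproof d e : `[< forall x y : A,
  (der_end d * der_end e - der_end e * der_end d) (x * y)
  = x * ((der_end d * der_end e - der_end e * der_end d) y : A)
    + ((der_end d * der_end e - der_end e * der_end d) x : A) * y >].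
Proof.
apply/asboolP => x y /=; rewrite !derM !kendD !derM mulrBr mulrBl.
set p1 := x * d (e y); set p2 := d x * e y; set p3 := e x * d y.
set p4 := d (e x) * y; set q1 := x * e (d y); set q4 := e (d x) * y.
have -> : p1 + p2 + (p3 + p4) = p1 - q1 + (p4 - q4) + (q1 + p3 + (p2 + q4)).
  rewrite [RHS]addrACA [LHS]addrACA; congr (_ + _); first by rewrite addrA subrK.
  by rewrite [p2 + q4]addrC addrA subrK addrC.
by rewrite addrK.
Qed.
Definition der_bracket d e : der kA := Der (der_bracket_subproof d e).

(* The co-ideal {0, 1} of N. *)
Definition coideal01 : coideal 1.
Proof.
refine (@Coideal 1 [pred a : 'X_{1..1} | (a ord0 <= 1)%N] _ _).
  move=> a b; rewrite !inE => a1 /mnm_lepP /(_ ord0) ba; exact: leq_trans ba a1.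
by exists 0%MM; rewrite inE mnm0E.
Defined.

(* Id + d s. *)
Definition hs_of_der_series d : tseries (kEnd kA A^o) coideal01 :=
  1 + tconst coideal01 (der_end d) * tvar (kEnd kA A^o) coideal01 ord0.

Lemma hs_of_der_seriesE d a : hs_of_der_series d a =
  (if a == 0%MM then 1 else 0) + (if a == U_(ord0)%MM then der_end d else 0).
Proof.
rewrite tcoefD tcoef1 tcoefCM.
have [aD|aD] := boolP (a \in coideal01).
  by rewrite tmonE //; congr (_ + _); case: ifP; rewrite ?mulr1 ?mulr0.
rewrite (tcoef_out _ aD) mulr0 [a == U_(ord0)%MM]negbTE //.
by apply: contraNneq aD => ->; rewrite inE mnm1E.
Qed.

Fact hs_of_der_coef0 d : hs_of_der_series d 0%MM = 1.
Proof. by rewrite hs_of_der_seriesE eqxx eq_sym mnm1_eq0 addr0. Qed.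

Fact hs_of_der_leibniz d : leibniz (hs_of_der_series d).
Proof.
have U0 : (U_(ord0 : 'I_1) == 0 :> 'X_{1..1})%MM = false by rewrite mnm1_eq0.
move=> a a1 x y; have [->|a0] := eqVneq a 0%MM.
  by rewrite convsum_0 !hs_of_der_seriesE eqxx [0%MM == _]eq_sym U0 addr0.
have -> : a = U_(ord0)%MM.
  apply/mnmP => i; rewrite (ord1 i) mnm1E eqxx; apply/eqP.
  rewrite eqn_leq [(a ord0 <= 1)%N]a1 lt0n; apply: contra a0 => /eqP a0.
  by apply/eqP/mnmP => j; rewrite (ord1 j) a0 mnm0E.
rewrite convsum_1 !hs_of_der_seriesE !eqxx [0%MM == _]eq_sym U0 addr0 add0r.
exact: derM.
Qed.

Definition hs_of_der d : hsder kA coideal01 :=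
  HSDer (hs_of_der_coef0 d) (@hs_of_der_leibniz d).

Record LRadmissible (R : algOver kA) (nabla : der kA -> R) : Prop := {
  lr_add : forall d e, nabla (d + e) = nabla d + nabla e;
  lr_scale : forall (a : A) d, nabla (a *: d) = alg_iota R a * nabla d;
  lr_leibniz : forall d (a : A),
    nabla d * alg_iota R a = alg_iota R a * nabla d + alg_iota R (d a : A);
  lr_bracket : forall d e,
    nabla (der_bracket d e) = nabla d * nabla e - nabla e * nabla d }.

End Derivations.

Record category := Category {
  obj :> Type;
  hom : obj -> obj -> Type;
  idm : forall X, hom X X;
  comp : forall X Y Z, hom Y Z -> hom X Y -> hom X Z;
  comp_idl : forall X Y (f : hom X Y), comp (idm Y) f = f;
  comp_idr : forall X Y (f : hom X Y), comp f (idm X) = f;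
  comp_assoc : forall X Y Z W (h : hom Z W) (g : hom Y Z) (f : hom X Y),
    comp h (comp g f) = comp (comp h g) f }.

Record functor (C D : category) := Functor {
  fobj :> C -> D;
  fmap : forall X Y, hom X Y -> hom (fobj X) (fobj Y);
  fmap_id : forall X, fmap (idm X) = idm (fobj X);
  fmap_comp : forall X Y Z (g : hom Y Z) (f : hom X Y),
    fmap (comp g f) = comp (fmap g) (fmap f) }.

Definition functor_id (C : category) : functor C C :=
  @Functor C C id (fun _ _ f => f) (fun _ => erefl) (fun _ _ _ _ _ => erefl).

Section FunctorComp.
Variables (C D E : category) (G : functor D E) (F : functor C D).

Fact functor_comp_id X : fmap G (fmap F (idm X)) = idm (G (F X)).
Proof. by rewrite !fmap_id. Qed.

Fact functor_comp_comp X Y Z (g : hom Y Z) (f : hom X Y) :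
  fmap G (fmap F (comp g f)) = comp (fmap G (fmap F g)) (fmap G (fmap F f)).
Proof. by rewrite !fmap_comp. Qed.

Definition functor_comp : functor C E :=
  @Functor C E (fun X => G (F X)) (fun X Y f => fmap G (fmap F f))
    functor_comp_id functor_comp_comp.
End FunctorComp.

Definition isomorphism_of_categories (C D : category) (F : functor C D) : Prop :=
  exists G : functor D C,
    functor_comp G F = functor_id C /\ functor_comp F G = functor_id D.

(* Selects left or right HS-modules and integrable connections. *)
Inductive side := Left | Right.

Section Modules.
Variables (k A : comPzRingType) (kA : {rmorphism k -> A}) (sd : side).

(* End_k(E) for left modules, End_k(E)^opp for right modules. *)
Definition sideAlg (E : lmodType A) : algOver kA :=
  match sd with Left => kEndAlg kA E | Right => kEndOppAlg kA E end.

(* An element of End_k(E) or End_k(E)^opp, as an endomorphism of E. *)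
Definition sideEnd (E : lmodType A) : sideAlg E -> kEnd kA E :=
  match sd return
    (match sd with Left => kEndAlg kA E | Right => kEndOppAlg kA E end : algOver kA)
    -> kEnd kA E
  with Left => fun f => f | Right => fun f => f end.

Record hsModule := HSModule {
  hsm_mod :> lmodType A;
  hsm_str : hsStructure (sideAlg hsm_mod) }.

Record hsMap (M N : hsModule) := HSMap {
  hsmap_fun :> M -> N;
  hsmap_linear : linear hsmap_fun;
  hsmap_comm : forall p (Delta : coideal p) (a : 'X_{1..p})
      (D : hsder kA Delta) (x : M), a \in Delta ->
    hsmap_fun (sideEnd (hs_map (hsm_str M) D a) x)
    = sideEnd (hs_map (hsm_str N) D a) (hsmap_fun x) }.

Record connModule := ConnModule {
  conn_mod :> lmodType A;
  conn_nabla : der kA -> sideAlg conn_mod;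
  conn_LR : LRadmissible conn_nabla }.

Record connMap (M N : connModule) := ConnMap {
  connmap_fun :> M -> N;
  connmap_linear : linear connmap_fun;
  connmap_comm : forall (d : der kA) (x : M),
    connmap_fun (sideEnd (conn_nabla M d) x)
    = sideEnd (conn_nabla N d) (connmap_fun x) }.

Lemma hsmap_eqP M N (f g : hsMap M N) : (forall x, f x = g x) -> f = g.
Proof.
case: f g => [f fl fc] [g gl gc] /= /funext fg.
by case: g / fg gl gc => gl gc; congr HSMap; apply: Prop_irrelevance.
Qed.

Fact hsmap_id_linear (M : hsModule) : linear (fun x : M => x).
Proof. by []. Qed.
Definition hsmap_id (M : hsModule) : hsMap M M :=
  @HSMap M M (fun x => x) (@hsmap_id_linear M) (fun _ _ _ _ _ _ => erefl).

Section HSMapComp.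
Variables (M N P : hsModule) (g : hsMap N P) (f : hsMap M N).

Fact hsmap_comp_linear : linear (fun x : M => g (f x)).
Proof. by move=> a x y; rewrite !hsmap_linear. Qed.

Fact hsmap_comp_comm p (Delta : coideal p) (a : 'X_{1..p})
    (D : hsder kA Delta) (x : M) : a \in Delta ->
  g (f (sideEnd (hs_map (hsm_str M) D a) x))
  = sideEnd (hs_map (hsm_str P) D a) (g (f x)).
Proof. by move=> aD; rewrite !hsmap_comm. Qed.

Definition hsmap_comp : hsMap M P := HSMap hsmap_comp_linear hsmap_comp_comm.

End HSMapComp.

Definition hsModuleCategory : category.
Proof.
refine (@Category hsModule hsMap hsmap_id hsmap_comp _ _ _).
- by move=> M N f; apply: hsmap_eqP.
- by move=> M N f; apply: hsmap_eqP.
- by move=> M N P Q h g f; apply: hsmap_eqP.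
Defined.

Lemma connmap_eqP M N (f g : connMap M N) : (forall x, f x = g x) -> f = g.
Proof.
case: f g => [f fl fc] [g gl gc] /= /funext fg.
by case: g / fg gl gc => gl gc; congr ConnMap; apply: Prop_irrelevance.
Qed.

Fact connmap_id_linear (M : connModule) : linear (fun x : M => x).
Proof. by []. Qed.
Definition connmap_id (M : connModule) : connMap M M :=
  @ConnMap M M (fun x => x) (@connmap_id_linear M) (fun _ _ => erefl).

Section ConnMapComp.
Variables (M N P : connModule) (g : connMap N P) (f : connMap M N).

Fact connmap_comp_linear : linear (fun x : M => g (f x)).
Proof. by move=> a x y; rewrite !connmap_linear. Qed.

Fact connmap_comp_comm (d : der kA) (x : M) :
  g (f (sideEnd (conn_nabla M d) x)) = sideEnd (conn_nabla P d) (g (f x)).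
Proof. by rewrite !connmap_comm. Qed.

Definition connmap_comp : connMap M P :=
  ConnMap connmap_comp_linear connmap_comp_comm.

End ConnMapComp.

Definition connModuleCategory : category.
Proof.
refine (@Category connModule connMap connmap_id connmap_comp _ _ _).
- by move=> M N f; apply: connmap_eqP.
- by move=> M N f; apply: connmap_eqP.
- by move=> M N P Q h g f; apply: connmap_eqP.
Defined.

Section HSToConn.
Variable nabla : forall M : hsModule, der kA -> sideAlg M.
Hypothesis nabla_LR : forall M, LRadmissible (nabla M).
Hypothesis nabla_comm : forall (M N : hsModule) (f : hsMap M N) d (x : M),
  f (sideEnd (nabla M d) x) = sideEnd (nabla N d) (f x).

Definition hs_to_conn_obj (M : hsModule) : connModule :=
  ConnModule (nabla_LR M).

Definition hs_to_conn_map (M N : hsModule) (f : hsMap M N) :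
    connMap (hs_to_conn_obj M) (hs_to_conn_obj N) :=
  @ConnMap (hs_to_conn_obj M) (hs_to_conn_obj N) f
    (@hsmap_linear _ _ f) (nabla_comm f).

(* The functor (E, Psi) |-> (E, nabla), the identity on the underlying maps. *)
Definition hs_to_conn : functor hsModuleCategory connModuleCategory.
Proof.
refine (@Functor hsModuleCategory connModuleCategory
  hs_to_conn_obj hs_to_conn_map _ _).
- by move=> M; apply: connmap_eqP.
- by move=> M N P g f; apply: connmap_eqP.
Defined.

End HSToConn.

End Modules.

(* Main.v *)
Require Import Defs.
From HB Require Import structures.
From mathcomp Require Import all_boot all_order all_algebra.
From mathcomp Require Import mpoly.
From mathcomp Require Import boolp.
Import GRing.Theory.
Local Open Scope ring_scope.

(** Let E be the Euler derivation, which multiplies the coefficient of s^a by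
    |a|. Every D in HS^p(A; Delta) satisfies E(D) = D e for a unique series e
    with coefficients in Der_k(A), and since Q is contained in k, D is the only
    solution with D_0 = 1. Given an LR-admissible map nabla to R, the HS-structure
    is D |-> P, where P_0 = 1 and E(P) = P nabla(e).

    Everything rests on a transfer principle: if P a = D(a) P for all a in A,
    then the pairs (D h, P nabla(h)), with h a series of derivations, are stable
    under sums and under left multiplication by A[[s]]. It yields
    multiplicativity through the conjugates D^-1 h D, and compatibility with a
    substitution phi by applying E to phi(D) = sum_a phi(s^a) D_a and using the
    partial derivatives of D. The latter need all of N^p: for a general Delta one
    first extends e by zero, hence D to an HS-derivation indexed by N^p.

    Conversely the coefficient nabla of an HS-structure is LR-admissible: its
    compatibility with brackets is read off the commutator of 1 + d s and
    1 + d' t in the co-ideal {0,1}^2. For uniqueness, truncate to the co-ideal of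
    the b <= a. The discrepancy between two structures in degree a is additive in
    D, and s |-> 2 s multiplies it by 2^|a|; comparing this substitution with the
    2^j-th power reduces D to 1 + D_a s^a, where D_a is a derivation and the
    substitution s |-> s^a applies. *)

Set Implicit Arguments.
Unset Strict Implicit.
Unset Printing Implicit Defensive.

(** * Truncated series and the Euler derivation *)

Section Agree.
Variables (M : zmodType) (p : nat) (Delta : coideal p).
Implicit Types f g h : tseries M Delta.

(** Congruence modulo the terms of degree at least n. Identities between series are proved by
    induction on n, each step gaining one degree. *)
Definition agree n f g := forall a : 'X_{1..p}, (mdeg a < n)%N -> f a = g a.

Lemma agree_sym n f g : agree n f g -> agree n g f.
Proof. by move=> fg a /fg. Qed.

Lemma agree_trans n g f h : agree n f g -> agree n g h -> agree n f h.
Proof. by move=> fg gh a lt_a; rewrite fg ?gh. Qed.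

Lemma agreeW m n f g : (m <= n)%N -> agree n f g -> agree m f g.
Proof. by move=> le_mn fg a lt_a; apply: fg; apply: leq_trans le_mn. Qed.

Lemma agreeP f g : (forall n, agree n f g) -> f = g.
Proof. by move=> fg; apply: tseriesP => a _; apply: (fg (mdeg a).+1). Qed.

Lemma agreeD n f f' g g' :
  agree n f f' -> agree n g g' -> agree n (f + g) (f' + g').
Proof. by move=> ff gg a lt_a; rewrite !tcoefD ff ?gg. Qed.

Lemma agree_sum n I (r : seq I) (P : pred I) (F G : I -> tseries M Delta) :
  (forall i, P i -> agree n (F i) (G i)) ->
  agree n (\sum_(i <- r | P i) F i) (\sum_(i <- r | P i) G i).
Proof.
by move=> FG a lt_a; rewrite !tcoef_sum; apply: eq_bigr => i /FG; apply.
Qed.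

Lemma agree1 f g : f 0%MM = g 0%MM -> agree 1 f g.
Proof. by move=> fg a; rewrite ltnS leqn0 mdeg_eq0 => /eqP ->. Qed.

(** Completeness for the degree filtration: the iterates of [F] from 0 are stationary in each
    degree, and their limit is read off coefficientwise. *)
Lemma contraction_fix (F : tseries M Delta -> tseries M Delta) :
  (forall n f g, agree n f g -> agree n.+1 (F f) (F g)) -> exists f, F f = f.
Proof.
move=> F_contr; pose u n := iter n F 0.
have u_agree n m : (n <= m)%N -> agree n (u n) (u m).
  elim: n m => [|n IHn] [|m] //; rewrite ltnS => /IHn; exact: F_contr.
pose f := trunc Delta (fun a => u (mdeg a).+1 a).
have f_agree n : agree n f (u n).
  move=> a lt_a; have [aD|aD] := boolP (a \in Delta); last by rewrite !tcoef_out.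
  by rewrite truncE //; apply: (u_agree _ _ lt_a).
exists f; apply: agreeP => n; apply: (@agreeW n n.+1) => //.
apply: agree_trans (agree_sym (f_agree n.+1)); exact: F_contr.
Qed.

Lemma tcoefN f a : (- f) a = - f a.
Proof. by apply: (addrI (f a)); rewrite -tcoefD !subrr tcoef0. Qed.

Lemma tcoefB f g a : (f - g) a = f a - g a.
Proof. by rewrite tcoefD tcoefN. Qed.

Lemma tcoefMn f n a : (f *+ n) a = f a *+ n.
Proof. by elim: n => [|n IHn]; rewrite ?tcoef0 // !mulrS tcoefD IHn. Qed.

Lemma trunc_ext (u : 'X_{1..p} -> M) a :
  (a \notin Delta -> u a = 0) -> trunc Delta u a = u a.
Proof.
by have [aD|aD u0] := boolP (a \in Delta); [rewrite truncE | rewrite tcoef_out // u0].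
Qed.

Definition euler f : tseries M Delta := trunc Delta (fun a => f a *+ mdeg a).

Lemma eulerE f a : euler f a = f a *+ mdeg a.
Proof. by apply: trunc_ext => aD; rewrite tcoef_out ?mul0rn. Qed.

Lemma eulerD f g : euler (f + g) = euler f + euler g.
Proof. by apply: tseriesP => a _; rewrite !(eulerE, tcoefD) mulrnDl. Qed.

Lemma eulerB f g : euler (f - g) = euler f - euler g.
Proof. by apply: tseriesP => a _; rewrite !(eulerE, tcoefB) mulrnBl. Qed.

Lemma euler_sum I (r : seq I) (P : pred I) (F : I -> tseries M Delta) :
  euler (\sum_(i <- r | P i) F i) = \sum_(i <- r | P i) euler (F i).
Proof.
apply: (big_morph euler eulerD).
by apply: tseriesP => a _; rewrite eulerE tcoef0 mul0rn.
Qed.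

Lemma agree_euler n f g : agree n f g -> agree n (euler f) (euler g).
Proof. by move=> fg a lt_a; rewrite !eulerE fg. Qed.

End Agree.

Section AgreeRing.
Variables (R : pzRingType) (p : nat) (Delta : coideal p).
Implicit Types f g h : tseries R Delta.

Lemma agreeM n f f' g g' :
  agree n f f' -> agree n g g' -> agree n (f * g) (f' * g').
Proof.
move=> ff gg a lt_a; have [aD|aD] := boolP (a \in Delta); last first.
  by rewrite !tcoef_out.
rewrite !tcoefM //; apply: eq_convsum => b c e.
by rewrite ff ?gg // (leq_trans _ lt_a) // e mdegD ltnS ?leq_addr ?leq_addl.
Qed.

Lemma agreeMl n h f g : agree n f g -> agree n (h * f) (h * g).
Proof. exact: agreeM. Qed.

Lemma agreeMr n h f g : agree n f g -> agree n (f * h) (g * h).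
Proof. by move=> fg; apply: agreeM. Qed.

Lemma mdeg_add_neq0 (b c : 'X_{1..p}) n :
  (mdeg (b + c) < n.+1)%N -> c != 0%MM -> (mdeg b < n)%N.
Proof.
rewrite -mdeg_eq0 -lt0n mdegD ltnS => le_n c0.
by apply: leq_trans le_n; rewrite -addn1 leq_add2l.
Qed.

(** The coefficient of h at 0 vanishes, so in degree n only coefficients of f and g of degree below
    n contribute. *)
Lemma agreeSMr n h f g : h 0%MM = 0 -> agree n f g -> agree n.+1 (f * h) (g * h).
Proof.
move=> h0 fg a lt_a; have [aD|aD] := boolP (a \in Delta); last first.
  by rewrite !tcoef_out.
rewrite !tcoefM //; apply: eq_convsum => b c e.
have [->|c0] := eqVneq c 0%MM; first by rewrite h0 !mulr0.
by rewrite fg //; apply: mdeg_add_neq0 c0; rewrite -e.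
Qed.

Lemma agreeSMl n h f g : h 0%MM = 0 -> agree n f g -> agree n.+1 (h * f) (h * g).
Proof.
move=> h0 fg a lt_a; have [aD|aD] := boolP (a \in Delta); last first.
  by rewrite !tcoef_out.
rewrite !tcoefM //; apply: eq_convsum => b c e.
have [->|b0] := eqVneq b 0%MM; first by rewrite h0 !mul0r.
by rewrite fg //; apply: mdeg_add_neq0 b0; rewrite addmC -e.
Qed.

(** The inverse is the fixed point of g |-> 1 - (f - 1) g, which is a contraction because f - 1 has
    no constant term. *)
Lemma tseries_rinv f : f 0%MM = 1 -> exists2 g, f * g = 1 & g 0%MM = 1.
Proof.
move=> f0; pose F g := 1 - (f - 1) * g.
have [n g g' gg|g Fg] := @contraction_fix _ _ Delta F.
  move=> a lt_a; rewrite !tcoefB; congr (_ - _); apply: agreeSMl gg _ lt_a.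
  by rewrite tcoefB tcoef1 eqxx f0 subrr.
exists g; last first.
  by rewrite -Fg tcoefB tcoefM0 tcoefB f0 tcoef1 eqxx subrr mul0r subr0.
have -> : f * g = (f - 1) * g + g by rewrite mulrBl mul1r subrK.
by rewrite -[X in _ + X]Fg addrC subrK.
Qed.

Lemma tseries_inv f : f 0%MM = 1 -> exists g, [/\ f * g = 1, g * f = 1 & g 0%MM = 1].
Proof.
move=> /tseries_rinv [g fg g0]; exists g; split => //.
have [h gh _] := tseries_rinv g0.
have -> // : f = h by rewrite -[f]mulr1 -gh mulrA fg mul1r.
Qed.

Lemma tseries_lreg f g h : f 0%MM = 1 -> f * g = f * h -> g = h.
Proof.
move=> /tseries_inv [f' [_ f'f _]] fgh.
by rewrite -[g]mul1r -f'f -mulrA fgh mulrA f'f mul1r.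
Qed.

Lemma agree_lreg n f g h :
  f 0%MM = 1 -> agree n (f * g) (f * h) -> agree n g h.
Proof.
move=> /tseries_inv [f' [_ f'f _]] /(agreeMl f').
by rewrite !mulrA f'f !mul1r.
Qed.

(** Any additive weight on exponents yields a derivation. The total degree gives the Euler
    derivation, the i-th exponent gives s_i d/ds_i. *)
Lemma weight_derivation (w : 'X_{1..p} -> nat) f g :
  (forall a b, w (a + b)%MM = (w a + w b)%N) ->
  trunc Delta (fun a => (f * g) a *+ w a)
  = trunc Delta (fun a => f a *+ w a) * g + f * trunc Delta (fun a => g a *+ w a).
Proof.
move=> wD; apply: tseriesP => a aD; rewrite tcoefD !tcoefM // -convsumD.
rewrite truncE // tcoefM // (convsum_morph (h := fun x => x *+ w a)) ?mul0rn //.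
  apply: eq_convsum => b c e; rewrite e in aD *.
  rewrite !truncE ?(coideal_addl aD) ?(coideal_addr aD) //.
  by rewrite wD mulrnDr mulrnAl mulrnAr.
by move=> x y; rewrite mulrnDl.
Qed.

Lemma eulerM f g : euler (f * g) = euler f * g + f * euler g.
Proof. by apply: weight_derivation => a b; rewrite mdegD. Qed.

Lemma euler_const (x : R) : euler (tconst Delta x) = 0.
Proof.
apply: tseriesP => a _; rewrite eulerE tconstE tcoef0.
by case: eqP => [->|_]; rewrite ?mdeg0 ?mulr0n ?mul0rn.
Qed.

Lemma euler1 : euler (1 : tseries R Delta) = 0.
Proof. exact: euler_const. Qed.

Lemma tconst0 : tconst Delta (0 : R) = 0.
Proof. by apply: tseriesP => a _; rewrite tconstE tcoef0 if_same. Qed.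

Lemma tconstD (x y : R) : tconst Delta (x + y) = tconst Delta x + tconst Delta y.
Proof. by apply: tseriesP => a _; rewrite tcoefD !tconstE; case: ifP; rewrite ?addr0. Qed.

Lemma tconstM (x y : R) : tconst Delta (x * y) = tconst Delta x * tconst Delta y.
Proof.
by apply: tseriesP => a _; rewrite tcoefCM !tconstE; case: ifP; rewrite ?mulr0.
Qed.

Lemma tmonC a f : tmon R Delta a * f = f * tmon R Delta a.
Proof.
apply: tseriesP => d dD; rewrite !tcoefM // convsumC; apply: eq_convsum => b c e.
rewrite tmonE; first by case: eqP; rewrite ?mulr1 ?mul1r ?mulr0 ?mul0r.
by apply: coideal_addr (_ : (b + c)%MM \in Delta); rewrite -e.
Qed.

Lemma tmon_out a : a \notin Delta -> tmon R Delta a = 0.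
Proof.
move=> aD; apply: tseriesP => b bD; rewrite tmonE // tcoef0.
by case: eqP => // e; rewrite -e bD in aD.
Qed.

Lemma ttermE (x : R) a : tterm Delta x a = tconst Delta x * tmon R Delta a.
Proof.
apply: tseriesP => b bD; rewrite tcoefCM tmonE // truncE //.
by case: ifP; rewrite ?mulr1 ?mulr0.
Qed.

Section Exp.
(** Divisibility by positive integers, which [alg_div_nat] derives from the map from Q to k. *)
Hypothesis div_nat : forall n, exists q : R, forall x : R, (q * x) *+ n.+1 = x.

Lemma nat_torsion_free n (x : R) : x *+ n.+1 = 0 -> x = 0.
Proof. by case: (div_nat n) => q qE x0; rewrite -[x]qE -mulrnAr x0 mulr0. Qed.

(** In degree |a| the right side only involves coefficients of f of lower degree, zero by induction,
    and multiplication by |a| is injective. *)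
Lemma euler_eq0 f g : g 0%MM = 0 -> f 0%MM = 0 -> euler f = f * g -> f = 0.
Proof.
move=> g0 f0 fg; apply: agreeP => n; elim: n => // n IHn a lt_a.
have := agreeSMr g0 IHn lt_a; rewrite -fg mul0r tcoef0 eulerE.
have [->|] := eqVneq a 0%MM; first by rewrite f0.
by rewrite -mdeg_eq0; case: (mdeg a) => // m _ /nat_torsion_free.
Qed.

Lemma euler_inj f g h : g 0%MM = 0 -> f 0%MM = h 0%MM ->
  euler f = f * g -> euler h = h * g -> f = h.
Proof.
move=> g0 fh ef eh; apply/eqP; rewrite -subr_eq0; apply/eqP.
apply: (euler_eq0 g0); first by rewrite tcoefB fh subrr.
by rewrite eulerB ef eh mulrBl.
Qed.

(** Dividing degree a by |a| turns the differential equation into a fixed point equation,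
    contracting because g has no constant term. *)
Lemma exp_exists g : g 0%MM = 0 ->
  exists f : tseries R Delta, f 0%MM = 1 /\ euler f = f * g.
Proof.
move=> g0; pose q n := sval (cid (div_nat n)).
have qE n x : (q n * x) *+ n.+1 = x by rewrite /q; case: cid.
(* [q n] divides by n + 1, whence the predecessor; at a = 0 the factor is irrelevant since f g has
   no constant term. *)
pose F f := 1 + trunc Delta (fun a => q (mdeg a).-1 * (f * g) a).
have FE f a : F f a = (1 : tseries R Delta) a + q (mdeg a).-1 * (f * g) a.
  by rewrite tcoefD [X in _ + X]trunc_ext // => aD; rewrite tcoef_out ?mulr0.
have [n f f' ff|f Ff] := @contraction_fix _ _ Delta F.
  by move=> a lt_a; rewrite !FE (agreeSMr g0 ff).
have f0 : f 0%MM = 1 by rewrite -Ff FE tcoefM0 g0 !mulr0 tcoef1 eqxx addr0.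
exists f; split=> //; apply: tseriesP => a _; rewrite eulerE -{1}Ff FE tcoef1.
have [->|a0] := eqVneq a 0%MM; first by rewrite tcoefM0 g0 mulr0 mdeg0.
by rewrite add0r; move: a0; rewrite -mdeg_eq0; case: (mdeg a).
Qed.

End Exp.
End AgreeRing.

(** * Series of derivations *)

Section Lift.
Variables (k A : comPzRingType) (kA : {rmorphism k -> A}) (R : algOver kA).
Local Notation EndA := (kEndAlg kA A^o).

Lemma alg_div_nat (QQ : {rmorphism rat -> k}) n :
  exists q : R, forall x : R, (q * x) *+ n.+1 = x.
Proof.
exists (alg_iota R (kA (QQ (n.+1%:R^-1)))) => x.
rewrite -mulrnAl -!rmorphMn -mulr_natr mulVf; last by rewrite Num.Theory.pnatr_eq0.
by rewrite !rmorph1 mul1r.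
Qed.

Variables (p : nat) (Delta : coideal p).
Implicit Types (f g : tseries A Delta) (P : tseries R Delta).
Implicit Types D G : tseries EndA Delta.

Lemma tliftD f g : tlift R (f + g) = tlift R f + tlift R g.
Proof. by apply: tseriesP => a _; rewrite !(tcoefD, tliftE) rmorphD. Qed.

Lemma tliftM f g : tlift R (f * g) = tlift R f * tlift R g.
Proof.
apply: tseriesP => a aD; rewrite tliftE !tcoefM // (convsum_morph (h := alg_iota R)).
- by apply: eq_convsum => b c _; rewrite !tliftE rmorphM.
- exact: rmorph0.
- exact: rmorphD.
Qed.

Lemma tlift0 : tlift R (0 : tseries A Delta) = 0.
Proof. by apply: tseriesP => a _; rewrite tliftE !tcoef0 rmorph0. Qed.

Lemma tlift_sum I (r : seq I) (Q : pred I) (F : I -> tseries A Delta) :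
  tlift R (\sum_(i <- r | Q i) F i) = \sum_(i <- r | Q i) tlift R (F i).
Proof.
by elim/big_rec2: _ => [|i g f _ <-]; rewrite (tlift0, tliftD).
Qed.

Lemma tlift_const x : tlift R (tconst Delta x) = tconst Delta (alg_iota R x).
Proof.
by apply: tseriesP => a _; rewrite tliftE !tconstE; case: ifP; rewrite ?rmorph0.
Qed.

Lemma tlift_mon a : tlift R (tmon A Delta a) = tmon R Delta a.
Proof.
apply: tseriesP => b bD; rewrite tliftE !tmonE //.
by case: ifP; rewrite ?rmorph0 ?rmorph1.
Qed.

Lemma tlift_euler f : tlift R (euler f) = euler (tlift R f).
Proof. by apply: tseriesP => a _; rewrite !(tliftE, eulerE) rmorphMn. Qed.

Lemma hs_app_euler D x : hs_app (euler D) x = euler (hs_app D x).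
Proof.
apply: tseriesP => a _; rewrite !(hs_appE, eulerE).
by elim: (mdeg a) => [|n IHn]; rewrite ?mulr0n // !mulrS -IHn.
Qed.

(* Condition (ii) of HS-structures. *)
Definition covariant D P := forall x : A,
  P * tconst Delta (alg_iota R x) = tlift R (hs_app D x) * P.

Lemma lift_app_coef P G x a : a \in Delta ->
  (P * tlift R (hs_app G x)) a
  = convsum (fun b c => (P * tconst Delta (alg_iota R (G c x : A))) b) a.
Proof.
move=> aD; rewrite tcoefM //; apply: eq_convsum => b c _.
by rewrite tliftE hs_appE tcoefMC.
Qed.

(** Regrouping the triple sum by the index of [G] leaves D acting on the single elements G_c(x), to
    which covariance applies. *)
Lemma lift_app_mul_coef P D G x a : a \in Delta ->
  (tlift R (hs_app (D * G) x) * P) a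
  = convsum (fun b c => (tlift R (hs_app D (G c x : A)) * P) b) a.
Proof.
move=> aD; pose F d c e := alg_iota R (D d (G c x) : A) * P e.
transitivity (convsum (fun b e => convsum (fun d c => F d c e) b) a).
  rewrite tcoefM //; apply: eq_convsum => b e aE.
  have bD : b \in Delta by apply: (@coideal_addl _ _ _ e); rewrite -aE.
  rewrite tliftE hs_appE tcoefM // convsum_kend.
  rewrite (convsum_morph (h := fun z : A => alg_iota R z * P e)) //.
    by rewrite rmorph0 mul0r.
  by move=> u v; rewrite rmorphD mulrDl.
rewrite -(convsumA F).
transitivity (convsum (fun d y => convsum (fun e c => F d c e) y) a).
  by apply: eq_convsum => d y _; rewrite convsumC.
rewrite (convsumA (fun d e c => F d c e)); apply: eq_convsum => b c aE.
have bD : b \in Delta by apply: (@coideal_addl _ _ _ c); rewrite -aE.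
by rewrite tcoefM //; apply: eq_convsum => d e _; rewrite tliftE hs_appE.
Qed.

(** Covariance extends from elements of A to series: moving P past G(x) lets D act on its
    coefficients, which gives (DG)(x). *)
Lemma covariant_app D P G x : covariant D P ->
  P * tlift R (hs_app G x) = tlift R (hs_app (D * G) x) * P.
Proof.
move=> DP; apply: tseriesP => a aD; rewrite lift_app_coef // lift_app_mul_coef //.
by apply: eq_convsum => b c _; rewrite DP.
Qed.

End Lift.

Arguments covariant {k A kA} R {p Delta} D P.

Section LiftEnd.
Variables (k A : comPzRingType) (kA : {rmorphism k -> A}).
Local Notation EndA := (kEndAlg kA A^o).
Variables (p : nat) (Delta : coideal p).

Lemma hs_app_tlift (f : tseries A Delta) : hs_app (tlift EndA f) 1 = f.
Proof.
by apply: tseriesP => a _; rewrite hs_appE tliftE /= /GRing.scale /= mulr1.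
Qed.

(* Left multiplication by f transported through a covariant pair: g is the
   preimage of f under the automorphism of A[[s]] defined by D. *)
Lemma covariant_lift (R : algOver kA) (D : tseries EndA Delta)
    (P : tseries R Delta) (f : tseries A Delta) :
  covariant EndA D D -> covariant R D P -> D 0%MM = 1 ->
  exists g, D * tlift EndA g = tlift EndA f * D
            /\ P * tlift R g = tlift R f * P.
Proof.
move=> DD DP D0; have [D' [D'r _ _]] := tseries_inv D0.
exists (hs_app (D' * tlift EndA f : tseries EndA Delta) 1).
by rewrite !(covariant_app _ _ DD, covariant_app _ _ DP) mulrA D'r mul1r hs_app_tlift.
Qed.

End LiftEnd.

Section DerSeries.
Variables (k A : comPzRingType) (kA : {rmorphism k -> A}).
Local Notation EndA := (kEndAlg kA A^o).

(** The inclusion of Der_k(A) in End_k(A) is itself LR-admissible, so statements on [nabla] also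
    apply to D. *)
Lemma der_end_LR : LRadmissible (R := EndA) (@der_end k A kA).
Proof.
split=> // d x; apply: kend_eqP => y /=.
rewrite [LHS]derM; congr (_ + _); exact: mulrC.
Qed.

Variables (R : algOver kA) (nabla : der kA -> R).
Hypothesis nabla_LR : LRadmissible nabla.

Lemma nablaD d e : nabla (d + e) = nabla d + nabla e.
Proof. exact: lr_add nabla_LR d e. Qed.

Lemma nabla0 : nabla 0 = 0.
Proof. by apply: (addrI (nabla 0)); rewrite -nablaD !addr0. Qed.

Lemma nablaMn d n : nabla (d *+ n) = nabla d *+ n.
Proof. by elim: n => [|n IHn]; rewrite ?nabla0 // !mulrS nablaD IHn. Qed.

Variables (p : nat) (Delta : coideal p).
Implicit Types e h : tseries (der kA) Delta.

Definition nser e : tseries R Delta := trunc Delta (fun a => nabla (e a)).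

Lemma nserE e a : nser e a = nabla (e a).
Proof. by apply: trunc_ext => aD; rewrite tcoef_out ?nabla0. Qed.

Lemma nserD e h : nser (e + h) = nser e + nser h.
Proof. by apply: tseriesP => a _; rewrite !(tcoefD, nserE) nablaD. Qed.

Lemma nser0 : nser 0 = 0.
Proof. by apply: tseriesP => a _; rewrite !(tcoef0, nserE) nabla0. Qed.

Lemma nser_euler e : nser (euler e) = euler (nser e).
Proof. by apply: tseriesP => a _; rewrite !(eulerE, nserE) nablaMn. Qed.

Lemma agree_nser n e h : agree n e h -> agree n (nser e) (nser h).
Proof. by move=> eh a /eh; rewrite !nserE => ->. Qed.

Definition dconst (d : der kA) : tseries (der kA) Delta :=
  trunc Delta (fun a => if a == 0%MM then d else 0).

Lemma dconstE d a : dconst d a = if a == 0%MM then d else 0.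
Proof. by apply: trunc_ext; case: eqP => // ->; rewrite coideal0. Qed.

Lemma nser_const d : nser (dconst d) = tconst Delta (nabla d).
Proof.
apply: tseriesP => a _; rewrite nserE dconstE tconstE.
by case: ifP; rewrite ?nabla0.
Qed.

(** The Lie bracket of series of derivations with central variables; the coefficients are not
    differentiated by one another. *)
Definition tbracket e h : tseries (der kA) Delta :=
  trunc Delta (convsum (fun b c => der_bracket (e b) (h c))).

Lemma nser_bracket e h : nser (tbracket e h) = nser e * nser h - nser h * nser e.
Proof.
apply: tseriesP => a aD; rewrite nserE truncE // tcoefB !tcoefM //.
rewrite (convsum_morph (h := nabla) _ _ nabla0 nablaD).
apply/eqP; rewrite eq_sym subr_eq; apply/eqP.
rewrite [X in _ = _ + X]convsumC -convsumD; apply: eq_convsum => b c _.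
by rewrite (lr_bracket nabla_LR) !nserE subrK.
Qed.

Definition tscale (f : tseries A Delta) e : tseries (der kA) Delta :=
  trunc Delta (convsum (fun b c => f b *: e c)).

Lemma nser_scale f e : nser (tscale f e) = tlift R f * nser e.
Proof.
apply: tseriesP => a aD; rewrite nserE truncE // tcoefM //.
rewrite (convsum_morph (h := nabla) _ _ nabla0 nablaD).
by apply: eq_convsum => b c _; rewrite (lr_scale nabla_LR) nserE tliftE.
Qed.

End DerSeries.

Section DerSeriesEnd.
Variables (k A : comPzRingType) (kA : {rmorphism k -> A}).
Local Notation EndA := (kEndAlg kA A^o).
Variables (p : nat) (Delta : coideal p).
Implicit Types e h : tseries (der kA) Delta.

Definition dser e : tseries EndA Delta := nser (R := EndA) (@der_end k A kA) e.

Lemma dserE e a : dser e a = der_end (e a).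
Proof. exact: (nserE (@der_end_LR k A kA)). Qed.

Lemma dser_agree n e h : agree n (dser e) (dser h) -> agree n e h.
Proof. by move=> eh a /eh; rewrite !dserE => /val_inj. Qed.

Lemma dser_inj e h : dser e = dser h -> e = h.
Proof. by move=> eh; apply: agreeP => n; apply: dser_agree; rewrite eh. Qed.

Lemma nser_leibniz (R : algOver kA) (nabla : der kA -> R) e x :
  LRadmissible nabla ->
  nser nabla e * tconst Delta (alg_iota R x)
  = tconst Delta (alg_iota R x) * nser nabla e + tlift R (hs_app (dser e) x).
Proof.
move=> nabla_LR; apply: tseriesP => a _.
rewrite tcoefD tcoefMC tcoefCM tliftE hs_appE dserE (nserE nabla_LR).
exact: lr_leibniz.
Qed.

(* The hypothesis says that G is a derivation along D, so D^-1 G takes values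
   in derivations. *)
Lemma der_series_exists (D G : tseries EndA Delta) :
  covariant EndA D D -> D 0%MM = 1 ->
  (forall x : A, G * tconst Delta (alg_iota EndA x)
     = tlift EndA (hs_app G x) * D + tlift EndA (hs_app D x) * G) ->
  exists e, G = D * dser e.
Proof.
move=> DD D0 GD; have [D' [DD' _ _]] := tseries_inv D0.
have [X GE] : exists X, G = D * X by exists (D' * G); rewrite mulrA DD' mul1r.
have XE x : X * tconst Delta (alg_iota EndA x)
    = tconst Delta (alg_iota EndA x) * X + tlift EndA (hs_app X x).
  apply: (tseries_lreg D0); rewrite mulrA -GE GD mulrDr [X in _ = _ + X](covariant_app _ _ DD).
  by rewrite -GE mulrA DD -mulrA -GE addrC.
have Xder a : `[< forall x y : A, X a (x * y) = x * (X a y : A) + (X a x : A) * y >].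
  apply/asboolP => x y; have /(congr1 (fun f => tcoef f a)) := XE x.
  rewrite tcoefMC tcoefD tcoefCM tliftE hs_appE.
  by move=> /(congr1 (fun f : kEnd kA A^o => f y : A)) XaE; exact: XaE.
exists (trunc Delta (fun a => Der (Xder a))); rewrite {1}GE; congr (_ * _).
by apply: tseriesP => a aD; rewrite dserE truncE.
Qed.

End DerSeriesEnd.

(** * Sums of coefficients weighted by a family of series *)

Section WeightedSum.
Variables (k A : comPzRingType) (kA : {rmorphism k -> A}) (R : algOver kA).
Variables (p q : nat) (Omega : coideal q).

(* The sum of the m_a r_a; the coefficients are finite sums as soon as m_a
   has order at least |a|. *)
Definition wsum (m : 'X_{1..p} -> tseries A Omega) (r : 'X_{1..p} -> R) :
    tseries R Omega :=
  trunc Omega (fun w =>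
    \sum_(a : 'X_{1..p < (mdeg w).+1}) alg_iota R (m a w) * r a).

Definition order_family (m : 'X_{1..p} -> tseries A Omega) :=
  forall a w, (mdeg w < mdeg a)%N -> m a w = 0.

Lemma wsumE m r N w : order_family m -> (mdeg w < N)%N ->
  wsum m r w = \sum_(a : 'X_{1..p < N}) alg_iota R (m a w) * r a.
Proof.
move=> m_ord lt_w; rewrite /wsum trunc_ext => [|wO]; last first.
  by rewrite big1 // => a _; rewrite tcoef_out // rmorph0 mul0r.
rewrite -(@bsum_bound _ _ (mdeg w).+1 N (fun a => alg_iota R (m a w) * r a)) //.
by move=> b lt_wb; rewrite m_ord // rmorph0 mul0r.
Qed.

Lemma wsum_agree m r n N : order_family m -> (n <= N)%N ->
  agree n (wsum m r)
    (\sum_(a : 'X_{1..p < N}) tlift R (m a) * tconst Omega (r a)).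
Proof.
move=> m_ord le_nN w lt_w; rewrite (wsumE _ m_ord (leq_trans lt_w le_nN)).
by rewrite tcoef_sum; apply: eq_bigr => a _; rewrite tcoefMC tliftE.
Qed.

End WeightedSum.

Lemma order_tmon (A : comPzRingType) p (Delta : coideal p) :
  order_family (tmon A Delta).
Proof.
move=> a w lt_wa; have [wD|/tcoef_out-> //] := boolP (w \in Delta).
by rewrite tmonE //; case: eqP lt_wa => // ->; rewrite ltnn.
Qed.

Lemma wsum_tmon (k A : comPzRingType) (kA : {rmorphism k -> A}) (R : algOver kA)
    p (Delta : coideal p) (f : tseries R Delta) : wsum (tmon A Delta) f = f.
Proof.
apply: tseriesP => w wD.
rewrite (wsumE _ (@order_tmon A p Delta) (ltnSn _)).
rewrite (bigD1 (BMultinom (ltnSn (mdeg w)))) //= tmonE // eqxx rmorph1 mul1r.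
rewrite big1 ?addr0 // => a aw; rewrite tmonE // ifF ?rmorph0 ?mul0r //.
by apply: contraNF aw => /eqP e; rewrite bmeqP /= -e.
Qed.

(** * Logarithmic derivatives *)

Section LogPair.
Variables (k A : comPzRingType) (kA : {rmorphism k -> A}).
Variable QQ : {rmorphism rat -> k}.
Variables (R : algOver kA) (nabla : der kA -> R).
Hypothesis nabla_LR : LRadmissible nabla.
Variables (p : nat) (Delta : coideal p).
Local Notation EndA := (kEndAlg kA A^o).
Implicit Types (e h : tseries (der kA) Delta) (D : tseries EndA Delta).
Implicit Types P : tseries R Delta.

(** D and P are the exponentials of the same e, realized in End_k(A) and in R; P is the candidate
    image of D. *)
Record log_pair e D P : Prop := LogPair {
  log_coef0 : e 0%MM = 0;
  log_D0 : D 0%MM = 1;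
  log_P0 : P 0%MM = 1;
  log_D : euler D = D * dser e;
  log_P : euler P = P * nser nabla e }.

Lemma nser_coef0 e : e 0%MM = 0 -> nser nabla e 0%MM = 0.
Proof. by move=> e0; rewrite (nserE nabla_LR) e0 (nabla0 nabla_LR). Qed.

Lemma euler_agree (f g : tseries R Delta) n :
  f 0%MM = g 0%MM -> agree n (euler f) (euler g) -> agree n f g.
Proof.
move=> fg0 efg a lt_a; have := efg _ lt_a; rewrite !eulerE.
have [->//|] := eqVneq a 0%MM; rewrite -mdeg_eq0; case: (mdeg a) => // m _ fga.
apply/eqP; rewrite -subr_eq0; apply/eqP.
apply: (nat_torsion_free (@alg_div_nat _ _ _ R QQ) (n := m)).
by rewrite mulrnBl fga subrr.
Qed.

(** The Euler derivation is applied to both sides of P x = D(x) P. As e has no constant term,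
    agreement below degree n, for all x, gives agreement one degree further. *)
Lemma log_pair_covariant e D P : log_pair e D P -> covariant R D P.
Proof.
case=> e0 D0 P0 eD eP; have ne0 := nser_coef0 e0.
suff agr n x : agree n (P * tconst Delta (alg_iota R x)) (tlift R (hs_app D x) * P).
  by move=> x; apply: agreeP => n; apply: agr.
elim: n x => // n IHn x; apply: euler_agree.
  by rewrite tcoefMC tcoefM0 tliftE hs_appE D0 P0 mul1r mulr1.
rewrite !eulerM euler_const mulr0 addr0 -tlift_euler -hs_app_euler eD eP.
rewrite -mulrA (nser_leibniz _ _ nabla_LR) mulrDr !mulrA addrC.
apply: agreeD; last exact: agreeSMr.
move=> a lt_a; have [aD|aD] := boolP (a \in Delta); last by rewrite !tcoef_out.
rewrite lift_app_coef // lift_app_mul_coef //; apply: eq_convsum => b c aE.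
(* The induction hypothesis is used for the element e_c(x) instead of x, in degree |b| < n; the term
   c = 0 vanishes since e_0 = 0. *)
have [->|c0] := eqVneq c 0%MM; last first.
  by apply: IHn; apply: mdeg_add_neq0 c0; rewrite -aE.
rewrite dserE e0 /= tcoefMC rmorph0 mulr0.
rewrite tcoefM; last by apply: (@coideal_addl _ _ _ c); rewrite -aE.
rewrite convsum0 // => u v _; rewrite tliftE hs_appE.
by rewrite (kend0 (D u : kEnd kA A^o)) rmorph0 mul0r.
Qed.

Lemma log_pair_uniq e D P P' : log_pair e D P -> log_pair e D P' -> P = P'.
Proof.
case=> e0 _ P0 _ eP [_ _ P'0 _ eP'].
apply: (euler_inj (@alg_div_nat _ _ _ R QQ) (nser_coef0 e0)) eP eP'.
by rewrite P0 P'0.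
Qed.

Lemma log_pair_uniq_log e h D P P' :
  log_pair e D P -> log_pair h D P' -> e = h.
Proof.
case=> _ D0 _ eD _ [_ _ _ hD _]; apply: dser_inj; apply: (tseries_lreg D0).
by rewrite -eD -hD.
Qed.

(** Applying the Euler derivation to D x = D(x) D shows that E(D) is a derivation along D, hence of
    the form D e; P is then the exponential of nabla(e). *)
Lemma log_pair_exists D : covariant EndA D D -> D 0%MM = 1 ->
  exists e P, log_pair e D P.
Proof.
move=> DD D0; have [|e eD] := @der_series_exists _ _ _ _ _ D (euler D) DD D0.
  move=> x; have := congr1 (@euler _ _ _) (DD x).
  rewrite !eulerM euler_const mulr0 addr0 => ->.
  by rewrite -tlift_euler -hs_app_euler.
have e0 : e 0%MM = 0.
  apply: val_inj; rewrite /= -dserE; have := congr1 (fun f => tcoef f 0%MM) eD.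
  by rewrite tcoefM0 D0 mul1r eulerE mdeg0 mulr0n => <-.
have [P [P0 eP]] := exp_exists (@alg_div_nat _ _ _ R QQ) (nser_coef0 e0).
by exists e, P.
Qed.

(** * Simultaneous realizations of series of derivations *)

Section Related.
Variables (D : tseries EndA Delta) (P : tseries R Delta).
Hypotheses (DD : covariant EndA D D) (DP : covariant R D P) (D0 : D 0%MM = 1).

(* Modulo degree n, X and Y are the products of D and P with the two
   realizations of the same series of derivations. *)
Definition related n (X : tseries EndA Delta) (Y : tseries R Delta) :=
  exists h, agree n X (D * dser h) /\ agree n Y (P * nser nabla h).

Lemma related_agree n X X' Y Y' : agree n X X' -> agree n Y Y' ->
  related n X Y -> related n X' Y'.
Proof.
move=> XX' YY' [h [Xh Yh]]; exists h.
split; [apply: agree_trans Xh | apply: agree_trans Yh]; exact: agree_sym.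
Qed.

Lemma related_sum n I (r : seq I) (Q : pred I) F G :
  (forall i, Q i -> related n (F i) (G i)) ->
  related n (\sum_(i <- r | Q i) F i) (\sum_(i <- r | Q i) G i).
Proof.
move=> FG; elim/big_rec2: _ => [|i Y X /FG [h [Xh Yh]] [h' [Xh' Yh']]].
  by exists 0; rewrite /dser (nser0 (@der_end_LR k A kA)) (nser0 nabla_LR) !mulr0.
exists (h + h'); rewrite /dser (nserD (@der_end_LR k A kA)) (nserD nabla_LR).
by split; rewrite mulrDr; apply: agreeD.
Qed.

(** The factor f crosses D and P as one and the same series g, which is absorbed into h by
    A-linearity of both realizations. *)
Lemma related_lift n f X Y : related n X Y ->
  related n (tlift EndA f * X) (tlift R f * Y).
Proof.
move=> [h [Xh Yh]]; have [g [Dg Pg]] := covariant_lift f DD DP D0.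
exists (tscale g h); rewrite /dser (nser_scale (@der_end_LR k A kA)).
rewrite (nser_scale nabla_LR) !mulrA Dg Pg -!mulrA.
by split; apply: agreeMl.
Qed.

(** D is invertible and derivations embed in End_k(A), so h is determined modulo degree n by X; the
    witnesses for all n therefore glue. *)
Lemma related_exists X Y : (forall n, related n X Y) ->
  exists h, X = D * dser h /\ Y = P * nser nabla h.
Proof.
move=> XY; pose u n := sval (cid (XY n)).
have uP n : agree n X (D * dser (u n)) /\ agree n Y (P * nser nabla (u n)).
  by rewrite /u; case: cid.
pose h := trunc Delta (fun a => u (mdeg a).+1 a).
have hu n : agree n h (u n).
  move=> a lt_a; have [aD|aD] := boolP (a \in Delta); last by rewrite !tcoef_out.
  rewrite truncE //; apply: (dser_agree (n := (mdeg a).+1)) => //.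
  apply: (agree_lreg D0); apply: agree_trans (agree_sym (uP _).1) _.
  exact: agreeW (uP n).1.
exists h; split; apply: agreeP => n.
  apply: agree_trans (uP n).1 _; apply: agreeMl; apply: agree_sym.
  exact: (agree_nser (@der_end_LR k A kA)).
apply: agree_trans (uP n).2 _; apply: agreeMl; apply: agree_sym.
exact: (agree_nser nabla_LR).
Qed.

Lemma related_const n d : related n (D * tconst Delta (der_end d : EndA))
  (P * tconst Delta (nabla d)).
Proof.
by exists (dconst Delta d); rewrite /dser (nser_const (@der_end_LR k A kA))
  (nser_const nabla_LR).
Qed.

End Related.

(** The conjugate c = D^-1 d D satisfies E(c) = [c, e] and c_0 = d. Transported to R, this makes P
    nabla(c) and nabla(d) P solutions of E(X) = X nabla(e) with equal constant terms. *)
Lemma log_pair_conj_const e D P d : covariant EndA D D -> log_pair e D P ->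
  exists c, tconst Delta (der_end d : EndA) * D = D * dser c /\
    tconst Delta (nabla d) * P = P * nser nabla c.
Proof.
move=> DD [e0 D0 P0 eD eP].
have [|c cE] := @der_series_exists _ _ _ _ _ D
    (tconst Delta (der_end d : EndA) * D) DD D0.
  move=> x; rewrite -mulrA DD mulrA.
  have -> : tconst Delta (der_end d : EndA) * tlift EndA (hs_app D x)
     = tlift EndA (hs_app D x) * tconst Delta (der_end d : EndA)
       + tlift EndA (hs_app (tconst Delta (der_end d : EndA) * D) x).
    apply: tseriesP => a _; rewrite tcoefD tcoefCM tcoefMC !tliftE !hs_appE.
    by rewrite tcoefCM; apply: (lr_leibniz (@der_end_LR k A kA) d).
  by rewrite mulrDl addrC mulrA.
exists c; split => //.
have c0 : c 0%MM = d.
  apply: val_inj; rewrite /= -dserE; have := congr1 (fun f => tcoef f 0%MM) cE.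
  by rewrite !tcoefM0 D0 mul1r mulr1 tconstE eqxx => <-.
have ec : euler c = tbracket c e.
  apply: dser_inj; rewrite /dser (nser_bracket (@der_end_LR k A kA)).
  rewrite (nser_euler (@der_end_LR k A kA)) -/(dser c) -/(dser e).
  have := congr1 (@euler _ _ _) cE; rewrite !eulerM euler_const mul0r add0r eD.
  rewrite mulrA cE -!mulrA -mulrDr => /(tseries_lreg D0) ->.
  by rewrite [X in X - _]addrC addrK.
apply: (euler_inj (@alg_div_nat _ _ _ R QQ) (nser_coef0 e0)).
- by rewrite !tcoefM0 P0 mul1r mulr1 tconstE eqxx (nserE nabla_LR) c0.
- by rewrite eulerM euler_const mul0r add0r eP mulrA.
rewrite eulerM -(nser_euler nabla_LR) ec (nser_bracket nabla_LR) eP.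
by rewrite mulrBr !mulrA addrC subrK.
Qed.

(** With d D' = D' c one gets E(D D') = D D' (c + e), and likewise in R; c comes from conjugating
    each coefficient of d. *)
Lemma log_pair_mul d e D D' P P' : covariant EndA D' D' ->
  log_pair d D P -> log_pair e D' P' ->
  exists h, log_pair h (D * D') (P * P').
Proof.
move=> DD' [d0 D0 P0 dD dP] eDP; have DP' := log_pair_covariant eDP.
have [e0 D'0 P'0 eD' eP'] := eDP.
have rel n : related D' P' n (dser d * D') (nser nabla d * P').
  (* Modulo degree n, d D' is the finite sum of the s^a d_a D', each handled by
     [log_pair_conj_const]. *)
  apply: (@related_agree _ _ n
    (\sum_(a : 'X_{1..p < n}) tlift EndA (tmon A Delta a)
       * (tconst Delta (der_end (d a) : EndA) * D')) _
    (\sum_(a : 'X_{1..p < n}) tlift R (tmon A Delta a)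
       * (tconst Delta (nabla (d a)) * P'))).
  - under eq_bigr => a _ do rewrite mulrA -dserE.
    rewrite -big_distrl; apply: agreeMr; apply: agree_sym.
    rewrite -[X in agree n X](wsum_tmon (R := EndA)).
    exact/wsum_agree/leqnn/order_tmon.
  - under eq_bigr => a _ do rewrite mulrA -(nserE nabla_LR).
    rewrite -big_distrl; apply: agreeMr; apply: agree_sym.
    rewrite -[X in agree n X](wsum_tmon (R := R)).
    exact/wsum_agree/leqnn/order_tmon.
  apply: related_sum => a _; apply: related_lift => //.
  have [c [cD cP]] := log_pair_conj_const (d a) DD' eDP.
  by exists c; rewrite cD cP.
have [c [cE cP]] := related_exists D'0 rel.
exists (c + e); split; try by rewrite tcoefM0 ?D0 ?D'0 ?P0 ?P'0 mulr1.
- suff c0 : c 0%MM = 0 by rewrite tcoefD c0 e0 addr0.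
  apply: val_inj; rewrite /= -dserE; have := congr1 (fun f => tcoef f 0%MM) cE.
  by rewrite !tcoefM0 D'0 mul1r mulr1 !dserE d0 => <-.
- rewrite eulerM dD eD' /dser (nserD (@der_end_LR k A kA)) mulrDr -!mulrA cE.
  by rewrite mulrA.
- rewrite eulerM dP eP' (nserD nabla_LR) mulrDr -!mulrA cP.
  by rewrite mulrA.
Qed.

End LogPair.

Lemma tseriesMC (A : comPzRingType) p (Delta : coideal p) (f g : tseries A Delta) :
  f * g = g * f.
Proof.
apply: tseriesP => a aD; rewrite !tcoefM // convsumC; apply: eq_convsum => b c _.
exact: mulrC.
Qed.

(** * Compatibility with substitutions *)

(** The family of the phi(s^a), detached from Delta so that it can be paired with series indexed by
    all of N^p. *)
Record mult_family (A : comPzRingType) p q (Omega : coideal q)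
    (m : 'X_{1..p} -> tseries A Omega) : Prop := MultFamily {
  mult_family0 : m 0%MM = 1;
  mult_familyD : forall a b, m (a + b)%MM = m a * m b;
  mult_family_order : order_family m }.

Section WeightedSumMul.
Variables (k A : comPzRingType) (kA : {rmorphism k -> A}) (R : algOver kA).
Variables (p q : nat) (Delta : coideal p) (Omega : coideal q).
Variable m : 'X_{1..p} -> tseries A Omega.
Hypotheses (m_mult : mult_family m) (m_out : forall a, a \notin Delta -> m a = 0).
Let m_ord := mult_family_order m_mult.

Lemma tconst_sum I (r : seq I) (Q : pred I) (F : I -> R) :
  tconst Omega (\sum_(i <- r | Q i) F i) = \sum_(i <- r | Q i) tconst Omega (F i).
Proof.
elim/big_rec2: _ => [|i x y _ <-]; [exact: tconst0 | exact: tconstD].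
Qed.

(** Elements of A need not commute with those of R, so [wsum m] is not multiplicative in general;
    keeping g coefficientwise on the right avoids any commutation. *)
Lemma wsumM n (f g : tseries R Delta) : agree n (wsum m (f * g))
  (\sum_(c : 'X_{1..p < n}) tlift R (m c) * wsum m f * tconst Omega (g c)).
Proof.
apply: agree_trans (wsum_agree _ m_ord (leqnn n)) _.
pose T b c := tlift R (m (b + c)%MM) * tconst Omega (f b * g c).
apply: (@agree_trans _ _ _ _ (\sum_(bc : 'X_{1..p < n, n}) T bc.1 bc.2)).
  apply: (@agree_trans _ _ _ _ (\sum_(a : 'X_{1..p < n})
     \sum_(bc : 'X_{1..p < n, n} | val a == (bc.1 + bc.2)%MM) T bc.1 bc.2)).
    apply: agree_sum => a _.
    have [aD|aD] := boolP (val a \in Delta); last first.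
      rewrite m_out // tlift0 mul0r big1 // => bc /eqP e.
      by rewrite /T -e m_out // tlift0 mul0r.
    rewrite tcoefM // (convsum_pair _ (bmdeg a)) tconst_sum big_distrr /=.
    by apply: agree_sum => bc /eqP e; rewrite /T -e.
  rewrite (exchange_big_dep xpredT) //=.
  apply: agree_sum => bc _.
  (* A pair of total degree at least n has no matching a, and its term has order at least n. *)
  have [lt|ge] := ltnP (mdeg (bc.1 + bc.2)%MM) n.
    by rewrite (big_pred1 (BMultinom lt)) // => a; rewrite bmeqP.
  rewrite big1 => [|a /eqP e]; last by rewrite leqNgt -e bmdeg in ge.
  move=> w lt_w; rewrite tcoef0 /T tcoefMC tliftE m_ord ?rmorph0 ?mul0r //.
  exact: leq_trans ge.
rewrite -(pair_bigA _ (fun b c : 'X_{1..p < n} => T b c)) exchange_big /=.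
apply: agree_sum => c _.
apply: agree_sym; apply: agree_trans (_ : agree n _ (tlift R (m c) *
  (\sum_(a : 'X_{1..p < n}) tlift R (m a) * tconst Omega (f a)) * tconst Omega (g c))) _.
  by apply: agreeMr; apply: agreeMl; apply: wsum_agree.
rewrite big_distrr big_distrl /=; apply: agree_sum => b _.
by rewrite /T mulrA -tliftM -(mult_familyD m_mult) -mulrA -tconstM addmC.
Qed.

End WeightedSumMul.

Definition full p : coideal p :=
  @Coideal p predT (fun _ _ _ _ => isT) (ex_intro _ 0%MM isT).

(** * Partial derivatives over N^p *)

Section PartialDerivation.
Variables (M : zmodType) (p : nat) (i : 'I_p).

Definition pderiv (f : tseries M (full p)) : tseries M (full p) :=
  trunc (full p) (fun a => f (a + U_(i))%MM *+ (a i).+1).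

Lemma pderivE f a : pderiv f a = f (a + U_(i))%MM *+ (a i).+1.
Proof. by rewrite truncE. Qed.

(** The operator s_i d/ds_i. It preserves degrees, hence commutes with the Euler derivation, and
    determines [pderiv] by cancelling s_i. *)
Definition wderiv (f : tseries M (full p)) : tseries M (full p) :=
  trunc (full p) (fun a => f a *+ a i).

Lemma wderivE f a : wderiv f a = f a *+ a i.
Proof. by rewrite truncE. Qed.

Lemma wderiv_euler f : wderiv (euler f) = euler (wderiv f).
Proof. by apply: tseriesP => a _; rewrite !(wderivE, eulerE) mulrnAC. Qed.

End PartialDerivation.

Section PartialDerivationRing.
Variables (R : pzRingType) (p : nat) (i : 'I_p).
Implicit Types f g : tseries R (full p).
Local Notation X := (tvar R (full p) i).

Lemma tvar_lreg f g : X * f = X * g -> f = g.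
Proof.
move=> fg; apply: tseriesP => a _.
have /(congr1 (fun f => tcoef f (U_(i) + a)%MM)) := fg.
by rewrite !tmonM lem_addr addmC addmK.
Qed.

Lemma tvar_pderiv f : X * pderiv i f = wderiv i f.
Proof.
apply: tseriesP => a _; rewrite tmonM wderivE andTb.
case: ifP => [Ua|/negbT Ua]; last first.
  rewrite (_ : a i = 0%N) ?mulr0n //; apply/eqP; rewrite -leqn0 leqNgt.
  apply: contra Ua => a0; apply/mnm_lepP => j; rewrite mnm1E.
  by case: eqP => // <-.
rewrite pderivE submK // mnmBE mnm1E eqxx.
by have /mnm_lepP/(_ i) := Ua; rewrite mnm1E eqxx; case: (a i) => // n; rewrite subn1.
Qed.

Lemma wderivM f g : wderiv i (f * g) = wderiv i f * g + f * wderiv i g.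
Proof. by apply: weight_derivation => a b; rewrite mnmDE. Qed.

Lemma pderivM f g : pderiv i (f * g) = pderiv i f * g + f * pderiv i g.
Proof.
apply: tvar_lreg; rewrite tvar_pderiv wderivM mulrDr mulrA tvar_pderiv.
by rewrite mulrA tmonC -mulrA tvar_pderiv.
Qed.

Lemma pderiv_const (x : R) : pderiv i (tconst (full p) x) = 0.
Proof.
apply: tseriesP => a _; rewrite pderivE tconstE ifF ?mul0rn ?tcoef0 //.
by apply/negbTE/eqP => /mnmP/(_ i); rewrite mnmDE mnm1E eqxx addn1 mnm0E.
Qed.

End PartialDerivationRing.

Section LogPairPartial.
Variables (k A : comPzRingType) (kA : {rmorphism k -> A}).
Variable QQ : {rmorphism rat -> k}.
Variables (R : algOver kA) (nabla : der kA -> R).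
Hypothesis nabla_LR : LRadmissible nabla.
Local Notation EndA := (kEndAlg kA A^o).
Variables (p : nat) (i : 'I_p).
Implicit Types (e : tseries (der kA) (full p)) (D : tseries EndA (full p)).

Lemma nser_wderiv (S : algOver kA) (nb : der kA -> S) e : LRadmissible nb ->
  nser nb (wderiv i e) = wderiv i (nser nb e).
Proof.
by move=> nbL; apply: tseriesP => a _; rewrite !(wderivE, nserE nbL) (nablaMn nbL).
Qed.

(** D^-1 times the partial derivative of D is a series of derivations g. Put c = s_i g: since s_i
    d/ds_i commutes with E, E(c) = [c, e] + s_i de/ds_i. The same equation in R forces the formula
    for P, after cancelling s_i. *)
Lemma log_pair_pderiv e D (P : tseries R (full p)) :
  covariant EndA D D -> log_pair nabla e D P ->
  exists g, pderiv i D = D * dser g /\ pderiv i P = P * nser nabla g.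
Proof.
move=> DD [e0 D0 P0 eD eP].
have DL := @der_end_LR k A kA.
have [|g gE] := @der_series_exists _ _ _ _ _ D (pderiv i D) DD D0.
  move=> x; have := congr1 (pderiv i) (DD x).
  rewrite !pderivM pderiv_const mulr0 addr0 => ->; congr (_ * _ + _).
  apply: tseriesP => a _; rewrite pderivE !tliftE !hs_appE pderivE.
  rewrite -rmorphMn; congr (alg_iota EndA _).
  by elim: (a i).+1 => [|n IHn]; rewrite ?mulr0n // !mulrS IHn.
exists g; split=> //.
pose c := tscale (tvar A (full p) i) g.
have cE (S : algOver kA) (nb : der kA -> S) : LRadmissible nb ->
    nser nb c = tvar S (full p) i * nser nb g.
  by move=> nbL; rewrite (nser_scale nbL) tlift_mon.
have wD : wderiv i D = D * dser c.
  by rewrite -tvar_pderiv gE /dser cE // !mulrA tmonC.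
have ec : euler c = tbracket c e + wderiv i e.
  apply: dser_inj; rewrite /dser (nserD DL) (nser_bracket DL) nser_wderiv //.
  rewrite (nser_euler DL) -/(dser c) -/(dser e).
  have := congr1 (@euler _ _ _) wD; rewrite -wderiv_euler eD wderivM eulerM eD wD.
  rewrite -!mulrA -!mulrDr => /(tseries_lreg D0) H.
  by rewrite addrAC H addrC addKr.
have ne0 := nser_coef0 nabla_LR e0.
suff wP : wderiv i P = P * nser nabla c.
  by apply: (@tvar_lreg _ _ i); rewrite tvar_pderiv wP cE // !mulrA tmonC.
apply/eqP; rewrite -subr_eq0; apply/eqP.
(* The difference of the two sides solves E(X) = X nabla(e) and has no constant term. *)
apply: (euler_eq0 (@alg_div_nat _ _ _ R QQ) ne0).
  rewrite tcoefB wderivE mnm0E mulr0n tcoefM0 cE // tcoefM0 tmonE //.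
  by rewrite eq_sym mnm1_eq0 mul0r mulr0 subr0.
rewrite eulerB -wderiv_euler eP wderivM eulerM -(nser_euler nabla_LR) ec.
rewrite (nserD nabla_LR) (nser_bracket nabla_LR) nser_wderiv // eP.
rewrite mulrDr mulrBr !mulrA mulrBl.
set u := wderiv i P * _; set v := P * wderiv i _.
set x := P * _ * _; set y := P * _ * _.
by rewrite addrA [x + _]addrC subrK opprD addrACA subrr addr0.
Qed.

End LogPairPartial.

Section EulerSum.
Variables (k A : comPzRingType) (kA : {rmorphism k -> A}) (R : algOver kA).
Variables (p q : nat) (Omega : coideal q).
Variable m : 'X_{1..p} -> tseries A Omega.
Hypothesis m_mult : mult_family m.
Let m_ord := mult_family_order m_mult.

Lemma mnm_subUK (a : 'X_{1..p}) i : (0 < a i)%N -> (a - U_(i) + U_(i))%MM = a.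
Proof.
move=> ai; apply: submK; apply/mnm_lepP => j; rewrite mnm1E.
by case: eqP => // <-.
Qed.

(** Leibniz rule for a monomial in the m_(U_i), by induction on |a|, splitting off one variable
    s_j. *)
Lemma euler_mult_family a :
  euler (m a) = \sum_i (euler (m U_(i)%MM) * m (a - U_(i))%MM) *+ a i.
Proof.
have [n] := ubnP (mdeg a); elim: n a => // n IHn a lt_a.
have [->|a0] := eqVneq a 0%MM.
  rewrite (mult_family0 m_mult) euler1 big1 // => i _.
  by rewrite mnm0E mulr0n.
have [j aj] : exists j, (0 < a j)%N.
  apply/existsP; apply: contraR a0 => /existsPn a0; apply/eqP/mnmP => i.
  by rewrite mnm0E; apply/eqP; rewrite -leqn0 leqNgt.
pose b := (a - U_(j))%MM; have aE : a = (b + U_(j))%MM by rewrite mnm_subUK.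
clearbody b.
have lt_b : (mdeg b < n)%N by move: lt_a; rewrite aE mdegD mdeg1 addn1.
rewrite {1}aE (mult_familyD m_mult) eulerM IHn // big_distrl /=.
have -> : m b * euler (m U_(j)%MM)
    = \sum_i (euler (m U_(i)%MM) * m (a - U_(i))%MM) *+ (j == i).
  rewrite (bigD1 j) //= eqxx mulr1n big1 ?addr0 => [|i]; first by rewrite aE addmK tseriesMC.
  by rewrite eq_sym => /negbTE ->.
rewrite -big_split /=; apply: eq_bigr => i _.
have -> : a i = (b i + (j == i))%N by rewrite {1}aE mnmDE mnm1E.
rewrite mulrnDr; congr (_ + _); rewrite mulrnAl -mulrA -(mult_familyD m_mult).
(* Subtraction of multi-indices is truncated; its value at b_i = 0 is multiplied by 0. *)
have [->|bi] := posnP (b i); first by rewrite !mulr0n.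
congr (_ * m _ *+ _); rewrite aE; apply/mnmP => l.
rewrite !(mnmDE, mnmBE) !mnm1E addnBAC //.
by case: eqP => // <-.
Qed.

Lemma bsum_shift (M : nmodType) n i (G : 'X_{1..p} -> M) :
  \sum_(a : 'X_{1..p < n.+1} | (0 < val a i)%N) G a
  = \sum_(b : 'X_{1..p < n}) G (b + U_(i))%MM.
Proof.
transitivity (\sum_(b : 'X_{1..p < n})
    \sum_(a : 'X_{1..p < n.+1} | val a == (b + U_(i))%MM) G a); last first.
  apply: eq_bigr => b _.
  have lt : (mdeg (b + U_(i))%MM < n.+1)%N by rewrite mdegD mdeg1 addn1 ltnS bmdeg.
  by rewrite (big_pred1 (BMultinom lt)) // => a; rewrite bmeqP.
rewrite (exchange_big_dep (fun a : 'X_{1..p < n.+1} => 0 < val a i)%N) /=.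
  apply: eq_bigr => a ai.
  have lt : (mdeg (val a - U_(i))%MM < n)%N.
    by have := bmdeg a; rewrite -{1}(mnm_subUK ai) mdegD mdeg1 addn1 ltnS.
  rewrite (big_pred1 (BMultinom lt)) // => b; rewrite /= bmeqP /=.
  apply/eqP/eqP => [->|->]; first by rewrite addmK.
  by rewrite mnm_subUK.
by move=> b a _ /eqP ->; rewrite mnmDE mnm1E eqxx addn1.
Qed.

(** The chain rule. *)
Lemma euler_wsum (r : tseries R (full p)) : euler (wsum m r)
  = \sum_i tlift R (euler (m U_(i)%MM)) * wsum m (pderiv i r).
Proof.
apply: agreeP => n.
(* The sum runs one degree beyond n because the shift by U_i lowers the degree of the index by
   one. *)
apply: agree_trans (agree_euler (wsum_agree r m_ord (leqnSn n))) _.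
rewrite euler_sum.
apply: (@agree_trans _ _ _ _ (\sum_i tlift R (euler (m U_(i)%MM)) *
   (\sum_(b : 'X_{1..p < n}) tlift R (m b) * tconst Omega (pderiv i r b)))).
  under eq_bigr => a _ do
    rewrite eulerM euler_const mulr0 addr0 -tlift_euler euler_mult_family
      tlift_sum big_distrl.
  rewrite exchange_big /=; apply: agree_sum => i _.
  rewrite big_distrr /= (bigID (fun a : 'X_{1..p < n.+1} => 0 < val a i)%N) /=.
  rewrite [X in _ + X]big1 ?addr0 => [|a]; last first.
    by rewrite -leqNgt leqn0 => /eqP ->; rewrite mulr0n tlift0 mul0r.
  rewrite (bsum_shift n i (fun a => tlift R ((euler (m U_(i)) * m (a - U_(i)))
     *+ a i) * tconst Omega (r a))).
  apply: agree_sum => b _; rewrite pderivE addmK mnmDE mnm1E eqxx addn1.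
  by move=> w _; rewrite mulrA -tliftM !tcoefMC !tliftE tcoefMn rmorphMn
    mulrnAl mulrnAr.
by apply: agree_sum => i _; apply: agreeMl; apply: agree_sym; apply: wsum_agree.
Qed.

End EulerSum.

Section LogPairSubst.
Variables (k A : comPzRingType) (kA : {rmorphism k -> A}).
Variable QQ : {rmorphism rat -> k}.
Variables (R : algOver kA) (nabla : der kA -> R).
Hypothesis nabla_LR : LRadmissible nabla.
Local Notation EndA := (kEndAlg kA A^o).
Local Notation der_end := (@der_end k A kA).
Let der_LR := @der_end_LR k A kA.

Lemma wsum_coef0 (S : algOver kA) p q (Omega : coideal q)
    (m : 'X_{1..p} -> tseries A Omega) (r : 'X_{1..p} -> S) :
  mult_family m -> wsum m r 0%MM = r 0%MM.
Proof.
move=> mm; have lt0 r' : (mdeg (0%MM : 'X_{1..r'}) < 1)%N by rewrite mdeg0.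
rewrite (wsumE r (mult_family_order mm) (lt0 q)).
rewrite (big_pred1 (BMultinom (lt0 p))) /= => [|b]; last first.
  by rewrite /= bmeqP /= -mdeg_eq0 -leqn0 -ltnS bmdeg.
by rewrite (mult_family0 mm) tcoef1 eqxx rmorph1 mul1r.
Qed.

(** By the chain rule E(F) is the sum of the E(m_(U_i)) times the images of D g_i, and [wsumM]
    rewrites the latter with F on the left of the coefficients of g_i. The same holds for Q, so F
    and Q have a common logarithmic derivative. *)
Lemma log_pair_wsum p q (Omega : coideal q) (m : 'X_{1..p} -> tseries A Omega)
    e (D : tseries EndA (full p)) (P : tseries R (full p)) :
  mult_family m -> log_pair nabla e D P -> covariant EndA D D ->
  covariant EndA (wsum m D : tseries EndA Omega) (wsum m D) ->
  covariant R (wsum m D : tseries EndA Omega) (wsum m P) ->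
  exists h, log_pair nabla h (wsum m D : tseries EndA Omega) (wsum m P).
Proof.
move=> mm eDP DD FF FQ; set F := wsum m D in FF FQ *; set Q := wsum m P in FQ *.
have [e0 D0 P0 eD eP] := eDP.
have F0 : F 0%MM = 1 by rewrite wsum_coef0.
have Q0 : Q 0%MM = 1 by rewrite wsum_coef0.
have rel n : related nabla F Q n (euler F) (euler Q).
  rewrite /F /Q !euler_wsum //; apply: (related_sum nabla_LR) => i _.
  apply: (related_lift nabla_LR) => //.
  have [g [-> ->]] := log_pair_pderiv QQ nabla_LR i DD eDP.
  have out a : a \notin full p -> m a = 0 by [].
  apply: (related_agree (agree_sym (wsumM mm out _ _)) (agree_sym (wsumM mm out _ _))).
  apply: (related_sum nabla_LR) => c _; rewrite -!mulrA.
  apply: (related_lift nabla_LR) => //; rewrite dserE (nserE nabla_LR).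
  exact: related_const.
have [h [hF hQ]] := related_exists nabla_LR F0 rel.
exists h; split=> //; apply: val_inj; rewrite /= -dserE.
have := congr1 (fun f => tcoef f 0%MM) hF.
by rewrite tcoefM0 F0 mul1r eulerE mdeg0 mulr0n => <-.
Qed.

Section Restriction.
Variables (p : nat) (Delta : coideal p).

Lemma trunc_mul (S : pzRingType) (f g : tseries S (full p)) :
  trunc Delta (f * g) = trunc Delta f * trunc Delta g.
Proof.
apply: tseriesP => a aD; rewrite tcoefM // truncE // tcoefM //.
apply: eq_convsum => b c aE; rewrite aE in aD.
by rewrite !truncE ?(coideal_addl aD) ?(coideal_addr aD).
Qed.

Lemma trunc_euler (S : zmodType) (f : tseries S (full p)) :
  trunc Delta (euler f) = euler (trunc Delta f).
Proof. by apply: tseriesP => a aD; rewrite eulerE !truncE // eulerE. Qed.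

Lemma log_pair_trunc e D (P : tseries R (full p)) : log_pair nabla e D P ->
  log_pair nabla (trunc Delta e) (trunc Delta D) (trunc Delta P).
Proof.
case=> e0 D0 P0 eD eP; split; rewrite ?truncE ?coideal0 //.
- rewrite -trunc_euler eD trunc_mul; congr (_ * _).
  by apply: tseriesP => a aD; rewrite truncE // !dserE truncE.
- rewrite -trunc_euler eP trunc_mul; congr (_ * _).
  by apply: tseriesP => a aD; rewrite truncE // !(nserE nabla_LR) truncE.
Qed.

End Restriction.

(** The logarithmic derivative e is extended by zero and exponentiated over N^p; uniqueness of
    exponentials over Delta identifies the truncations with D and P. *)
Lemma log_pair_extend p (Delta : coideal p) e D (P : tseries R Delta) :
  log_pair nabla e D P ->
  exists e' D' P', [/\ log_pair nabla e' D' P', covariant EndA D' D',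
    D = trunc Delta D' & P = trunc Delta (P' : tseries R (full p))].
Proof.
move=> eDP; have [e0 D0 P0 eD eP] := eDP.
pose e' := trunc (full p) e.
have e'0 : e' 0%MM = 0 by rewrite truncE.
have ee' : trunc Delta e' = e by apply: tseriesP => a aD; rewrite !truncE.
have [D' [D'0 eD']] := exp_exists (@alg_div_nat _ _ _ EndA QQ) (nser_coef0 der_LR e'0).
have [P' [P'0 eP']] := exp_exists (@alg_div_nat _ _ _ R QQ) (nser_coef0 nabla_LR e'0).
have eDP' : log_pair nabla e' D' P' by split.
have eDD' : log_pair (R := EndA) der_end e' D' D' by split.
exists e', D', P'; split=> //.
- exact: log_pair_covariant eDD'.
- have [_ d0 _ dE _] := log_pair_trunc Delta eDP'; rewrite ee' in dE.
  apply: (euler_inj (@alg_div_nat _ _ _ EndA QQ) (nser_coef0 der_LR e0)) eD dE.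
  by rewrite D0 d0.
- have [_ _ p0 _ pE] := log_pair_trunc Delta eDP'; rewrite ee' in pE.
  apply: (euler_inj (@alg_div_nat _ _ _ R QQ) (nser_coef0 nabla_LR e0)) eP pE.
  by rewrite P0 p0.
Qed.

Section Subst.
Variables (p q : nat) (Delta : coideal p) (Omega : coideal q).
Variable phi : substmap A Delta Omega.

Lemma subst_family : mult_family (fun a => phi (tmon A Delta a)).
Proof.
split; first by rewrite tmon0 rmorph1.
- by move=> a b; rewrite tmonD rmorphM.
- by move=> a w; apply: subst_tmon_order.
Qed.

(** Outside Delta the monomial s^a is zero, so the values of r' there are free. *)
Lemma subst_act_wsum (S : algOver kA) (r : tseries S Delta) r' :
  (forall a, a \in Delta -> r a = r' a) ->
  subst_act phi r = wsum (fun a => phi (tmon A Delta a)) r'.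
Proof.
move=> rr'; apply: tseriesP => w wO; rewrite (subst_actE _ _ wO (ltnSn _)).
rewrite truncE //; apply: eq_bigr => a _.
have [aD|aD] := boolP (val a \in Delta); first by rewrite rr'.
by rewrite tmon_out // rmorph0 tcoef0 rmorph0 !mul0r.
Qed.

Lemma covariant_subst D (P : tseries R Delta) :
  covariant R D P -> covariant R (subst_act phi (D : tseries EndA Delta)) (subst_act phi P).
Proof.
move=> DP x; rewrite -subst_act_constr DP subst_act_liftl; congr (tlift R _ * _).
apply: tseriesP => w wO; rewrite hs_appE (subst_actE _ _ wO (ltnSn _)).
rewrite (substE _ _ (ltnSn _)).
rewrite (big_morph (fun f : kEnd kA A^o => f x : A) (id1 := 0) (op1 := +%R)) //.
by apply: eq_bigr => a _; rewrite hs_appE.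
Qed.

Lemma log_pair_subst (D : hsder kA Delta) e P : log_pair nabla e D P ->
  exists h, log_pair nabla h (hs_subst phi D) (subst_act phi P).
Proof.
move=> eDP; have DP := log_pair_covariant QQ nabla_LR eDP.
have [e' [D' [P' [eDP' DD' DE PE]]]] := log_pair_extend eDP.
have FE : hs_series (hs_subst phi D)
    = wsum (R := EndA) (fun a => phi (tmon A Delta a)) D'.
  by apply: (@subst_act_wsum EndA) => a aD; rewrite DE truncE.
have QE : subst_act phi P = wsum (fun a => phi (tmon A Delta a)) P'.
  by apply: subst_act_wsum => a aD; rewrite PE truncE.
rewrite FE QE; apply: (log_pair_wsum subst_family eDP' DD').
  by rewrite -FE; apply/leibnizP/hs_leibniz.
by rewrite -FE -QE; apply: covariant_subst.
Qed.

End Subst.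

(** * The HS-structure of an LR-admissible map *)

Lemma hs_map_exists p (Delta : coideal p) (D : hsder kA Delta) :
  exists P, exists e, log_pair nabla e D P.
Proof.
have DD : covariant EndA (hs_series D) (hs_series D) by apply/leibnizP/hs_leibniz.
have [e [P eDP]] := log_pair_exists QQ nabla_LR DD (@hs_coef0 _ _ _ _ _ D).
by exists P, e.
Qed.

Definition conn_hs_map p (Delta : coideal p) (D : hsder kA Delta) : tseries R Delta :=
  sval (cid (hs_map_exists D)).

Lemma conn_hs_mapP p (Delta : coideal p) (D : hsder kA Delta) :
  exists e, log_pair nabla e D (conn_hs_map D).
Proof. by rewrite /conn_hs_map; case: cid. Qed.

(** The choice of P is immaterial: D determines e, and e determines P. *)
Lemma conn_hs_map_eq p (Delta : coideal p) (D : hsder kA Delta) e P :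
  log_pair nabla e D P -> conn_hs_map D = P.
Proof.
move=> eDP; have [h hDP] := conn_hs_mapP D.
apply: (log_pair_uniq QQ nabla_LR hDP).
by rewrite (log_pair_uniq_log hDP eDP).
Qed.

Definition conn_hs_structure : hsStructure R.
Proof.
refine (@HSStructure _ _ _ R conn_hs_map _ _ _ _) => p.
- by move=> Delta D; have [e []] := conn_hs_mapP D.
- move=> Delta D E; have [d dDP] := conn_hs_mapP D; have [e eEP] := conn_hs_mapP E.
  have EE : covariant EndA (hs_series E) (hs_series E).
    exact/leibnizP/hs_leibniz.
  have [h hDE] := log_pair_mul QQ nabla_LR EE dDP eEP.
  exact: (@conn_hs_map_eq _ _ (hs_mul D E) _ _ hDE).
- move=> Delta D; have [e eDP] := conn_hs_mapP D.
  exact: log_pair_covariant eDP.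
- move=> q Delta Omega phi D; have [e eDP] := conn_hs_mapP D.
  have [h hDP] := log_pair_subst phi eDP; exact: (@conn_hs_map_eq _ _ (hs_subst phi D) _ _ hDP).
Defined.

(** As s^2 = 0, the logarithmic derivative of 1 + d s is d s, in both realizations. *)
Lemma conn_hs_map_der d : conn_hs_map (hs_of_der d)
  = 1 + tconst coideal01 (nabla d) * tvar R coideal01 ord0.
Proof.
pose e := trunc coideal01 (fun a => if a == U_(ord0)%MM then d else 0).
have eE a : e a = if a == U_(ord0)%MM then d else 0.
  apply: trunc_ext; case: eqP => // -> /negP[].
  by rewrite inE mnm1E.
suff gen (S : algOver kA) (nb : der kA -> S) : LRadmissible nb ->
    let P := 1 + tconst coideal01 (nb d) * tvar S coideal01 ord0 in
    P 0%MM = 1 /\ euler P = P * nser nb e.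
  have [P0 eP] := gen _ _ nabla_LR; have [D0 eD] := gen _ _ der_LR.
  apply: (@conn_hs_map_eq _ _ _ e); split=> //.
  by rewrite eE eq_sym mnm1_eq0.
move=> nbL P.
have nE : nser nb e = tconst coideal01 (nb d) * tvar S coideal01 ord0.
  apply: tseriesP => a aD; rewrite (nserE nbL) eE tcoefCM tmonE //.
  by case: ifP; rewrite ?mulr1 ?mulr0 ?(nabla0 nbL).
split.
  rewrite tcoefD tcoef1 eqxx tcoefCM tmonE ?coideal0 //.
  by rewrite eq_sym mnm1_eq0 mulr0 addr0.
rewrite nE mulrDl mul1r eulerD euler1 add0r eulerM euler_const mul0r add0r.
have XX : tvar S coideal01 ord0 * tvar S coideal01 ord0 = 0.
  rewrite -tmonD tmon_out // inE mnmDE mnm1E //.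
rewrite -!mulrA [X in _ + _ * X]mulrA [X in _ + _ * (X * _)]tmonC -!mulrA XX !mulr0 addr0.
congr (_ * _); apply: tseriesP => a aD; rewrite eulerE tmonE //.
by case: eqP => [->|_]; rewrite ?mul0rn ?mdeg1.
Qed.

End LogPairSubst.

(** * The connection of an HS-structure *)

Section FamilySubst.
Variables (k A : comPzRingType) (kA : {rmorphism k -> A}).

Fact scalar_central (c : k) (x : A) :
  (idfun : {rmorphism A -> A}) (kA c) * x = x * (idfun : {rmorphism A -> A}) (kA c).
Proof. exact: mulrC. Qed.

(** A over itself: with these coefficients [wsum m] becomes a map between series over A. *)
Definition scalarAlg : algOver kA := AlgOver scalar_central.

Variables (p q : nat) (Delta : coideal p) (Omega : coideal q).
Variable m : 'X_{1..p} -> tseries A Omega.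
Hypotheses (m_mult : mult_family m) (m_out : forall a, a \notin Delta -> m a = 0).
Let m_ord := mult_family_order m_mult.

Lemma wsumD (R : algOver kA) (f g : tseries R Delta) :
  wsum m (f + g) = wsum m f + wsum m g.
Proof.
apply: tseriesP => w _; rewrite tcoefD !(wsumE _ m_ord (ltnSn _)) -big_split.
by apply: eq_bigr => a _; rewrite tcoefD mulrDr.
Qed.

Lemma wsum_term (R : algOver kA) (x : R) a : a \in Delta ->
  wsum m (tterm Delta x a) = tlift R (m a) * tconst Omega x.
Proof.
move=> aD; apply: agreeP => n.
pose N := maxn n (mdeg a).+1.
apply: agree_trans (wsum_agree _ m_ord (leq_maxl n (mdeg a).+1)) _.
have lt : (mdeg a < N)%N by rewrite leq_maxr.
rewrite (bigD1 (BMultinom lt)) //= truncE // eqxx big1 ?addr0 // => b ba.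
suff -> : tterm Delta x a b = 0 by rewrite tconst0 mulr0.
have [bD|bD] := boolP (val b \in Delta); last by rewrite tcoef_out.
by rewrite truncE // ifF //; apply: contraNF ba => /eqP e; rewrite bmeqP /= e.
Qed.

Lemma wsum1 (R : algOver kA) : wsum m (1 : tseries R Delta) = 1.
Proof.
rewrite (_ : 1 = tterm Delta (1 : R) 0%MM) // wsum_term ?coideal0 //.
rewrite (mult_family0 m_mult) mulr1.
by apply: tseriesP => w _; rewrite tliftE !tcoef1; case: ifP; rewrite ?rmorph0 ?rmorph1.
Qed.

Definition family_subst_fun (f : tseries A Delta) : tseries A Omega :=
  wsum (R := scalarAlg) m f.

Fact family_substB : zmod_morphism family_subst_fun.
Proof.
move=> f g; apply/eqP; rewrite eq_sym subr_eq; apply/eqP.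
by rewrite -(@wsumD scalarAlg) subrK.
Qed.

Lemma tlift_scalar r (Gamma : coideal r) (f : tseries A Gamma) : tlift scalarAlg f = f.
Proof. by apply: tseriesP => a _; rewrite tliftE. Qed.

Fact family_substM : monoid_morphism family_subst_fun.
Proof.
split; first by rewrite /family_subst_fun (@wsum_term scalarAlg) ?coideal0 //
  tlift_scalar (mult_family0 m_mult) mul1r.
move=> f g; apply: agreeP => n.
apply: agree_trans (@wsumM _ _ _ scalarAlg _ _ _ _ _ m_mult m_out n f g) _.
under eq_bigr => c _ do rewrite [_ * wsum _ _]tseriesMC -mulrA.
rewrite -big_distrr; apply: agreeMl; apply: agree_sym; exact: wsum_agree.
Qed.

HB.instance Definition _ := GRing.isZmodMorphism.Build _ _ family_subst_fun family_substB.
HB.instance Definition _ := GRing.isMonoidMorphism.Build _ _ family_subst_fun family_substM.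

Fact family_subst_const (x : A) :
  (family_subst_fun : {rmorphism _ -> _}) (tconst Delta x) = tconst Omega x.
Proof.
by rewrite /= /family_subst_fun (@wsum_term scalarAlg) ?coideal0 // tlift_scalar
  (mult_family0 m_mult) mul1r.
Qed.

Fact family_subst_var0 (i : 'I_p) :
  (family_subst_fun : {rmorphism _ -> _}) (tvar A Delta i) 0%MM = 0.
Proof.
by rewrite /= /family_subst_fun wsum_coef0 // tmonE ?coideal0 // eq_sym mnm1_eq0.
Qed.

(** The converse of [subst_family]: a multiplicative family vanishing outside Delta is a
    substitution map. *)
Definition family_subst : substmap A Delta Omega :=
  SubstMap family_subst_const family_subst_var0.

Lemma family_subst_act (R : algOver kA) (r : tseries R Delta) :
  subst_act family_subst r = wsum m r.
Proof.
rewrite (subst_act_wsum _ (r' := r)) //; congr wsum; apply/funext => a.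
have [aD|aD] := boolP (a \in Delta); last by rewrite tmon_out // rmorph0 m_out.
rewrite /= /family_subst_fun (@wsum_term scalarAlg) // tlift_scalar.
exact: mulr1.
Qed.

End FamilySubst.

Section MonomialFamily.
Variables (A : comPzRingType) (p q : nat) (Delta : coideal p) (Omega : coideal q).
Variables (x : A) (theta : 'X_{1..p} -> 'X_{1..q}).
Hypotheses (theta0 : theta 0%MM = 0%MM)
  (thetaD : forall a b, theta (a + b)%MM = (theta a + theta b)%MM)
  (theta_order : forall a, (mdeg a <= mdeg (theta a))%N).

(** One shape for all substitutions needed below: restriction and scaling of the variables (theta
    the identity) and s |-> t^g. *)
Definition monomial_family a : tseries A Omega :=
  tterm Omega (x ^+ mdeg a) (theta a).

Lemma monomial_family_mult : mult_family monomial_family.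
Proof.
split.
- by rewrite /monomial_family theta0 mdeg0 expr0.
- move=> a b; rewrite /monomial_family thetaD mdegD exprD !ttermE tmonD tconstM.
  by rewrite !mulrA; congr (_ * _); rewrite -!mulrA tmonC.
- move=> a w lt_wa; have [wO|/tcoef_out-> //] := boolP (w \in Omega).
  rewrite truncE // ifF //; apply: contraTF lt_wa => /eqP ->.
  by rewrite -leqNgt theta_order.
Qed.

Lemma monomial_family_out a : theta a \notin Omega -> monomial_family a = 0.
Proof. by move=> aO; rewrite /monomial_family ttermE tmon_out ?mulr0. Qed.

End MonomialFamily.

Lemma wsum_scale (k A : comPzRingType) (kA : {rmorphism k -> A}) (R : algOver kA)
    p (Delta : coideal p) (x : A) (r : 'X_{1..p} -> R) a : a \in Delta ->
  wsum (monomial_family Delta x id) r a = alg_iota R (x ^+ mdeg a) * r a.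
Proof.
move=> aD; have mm := @monomial_family_mult A p p Delta x id erefl
  (fun _ _ => erefl) (fun _ => leqnn _).
rewrite (wsumE r (mult_family_order mm) (ltnSn (mdeg a))).
rewrite (bigD1 (BMultinom (ltnSn (mdeg a)))) //= truncE // eqxx.
rewrite big1 ?addr0 // => b ba; rewrite truncE // ifF ?rmorph0 ?mul0r //.
by apply: contraNF ba => /eqP e; rewrite bmeqP /= -e.
Qed.

Lemma coideal01P a : a \in coideal01 -> a = 0%MM \/ a = U_(ord0)%MM.
Proof.
rewrite inE => a1; have [a0|a0] := posnP (a ord0); [left|right].
  by apply/mnmP => i; rewrite (ord1 i) a0 mnm0E.
by apply/mnmP => i; rewrite (ord1 i) mnm1E eqxx; apply/eqP; rewrite eqn_leq a1.
Qed.

Lemma mem_U01 : (U_(ord0)%MM : 'X_{1..1}) \in coideal01.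
Proof. by rewrite inE mnm1E. Qed.

Section HSStructures.
Variables (k A : comPzRingType) (kA : {rmorphism k -> A}) (R : algOver kA).
Local Notation EndA := (kEndAlg kA A^o).
Variable S : hsStructure R.

Lemma hsder_eqP p (Delta : coideal p) (D E : hsder kA Delta) :
  hs_series D = hs_series E -> D = E.
Proof.
case: D E => [D D0 DL] [E E0 EL] /= DE.
by case: E / DE E0 EL => E0 EL; congr HSDer; apply: Prop_irrelevance.
Qed.

Lemma hs_map_family p q (Delta : coideal p) (Omega : coideal q)
    (m : 'X_{1..p} -> tseries A Omega) (D : hsder kA Delta) (E : hsder kA Omega) :
  mult_family m -> (forall a, a \notin Delta -> m a = 0) ->
  hs_series E = wsum (R := EndA) m D -> hs_map S E = wsum m (hs_map S D).
Proof.
move=> mm mo ED; rewrite -(family_subst_act mm mo) -hs_map_subst.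
by congr hs_map; apply: hsder_eqP; rewrite ED -(family_subst_act mm mo).
Qed.

Lemma hs_family p q (Delta : coideal p) (Omega : coideal q)
    (m : 'X_{1..p} -> tseries A Omega) (D : hsder kA Delta) :
  mult_family m -> (forall a, a \notin Delta -> m a = 0) ->
  exists E : hsder kA Omega, hs_series E = wsum (R := EndA) m D.
Proof.
move=> mm mo; exists (hs_subst (family_subst kA mm mo) D).
exact: (family_subst_act mm mo (R := EndA)).
Qed.

Definition hs_nabla (d : der kA) : R := hs_map S (hs_of_der d) U_(ord0)%MM.

Lemma hs_map_der d : hs_map S (hs_of_der d)
  = 1 + tconst coideal01 (hs_nabla d) * tvar R coideal01 ord0.
Proof.
apply: tseriesP => a aD; rewrite tcoefD tcoef1 tcoefCM tmonE //.
case: (coideal01P aD) => ->.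
  by rewrite hs_map_coef0 eqxx eq_sym mnm1_eq0 mulr0 addr0.
by rewrite mnm1_eq0 eqxx add0r mulr1.
Qed.

Section PowerSubst.
Variables (q : nat) (Omega : coideal q) (g : 'X_{1..q}).
Hypotheses (g0 : g != 0%MM) (gg : (g + g)%MM \notin Omega).

(** The substitution s |-> t^g, defined on the co-ideal {0,1} because t^(2g) is zero in the
    target. *)
Definition power_family : 'X_{1..1} -> tseries A Omega :=
  monomial_family Omega 1 (fun a : 'X_{1..1} => (g *+ a ord0)%MM).

Lemma power_family_mult : mult_family power_family.
Proof.
apply: monomial_family_mult; first by rewrite mnm0E mulm0n.
  by move=> a b; apply/mnmP => i; rewrite !(mnmDE, mulmnE) mulnDr.
move=> a; rewrite mdegMn (mdegE a) big_ord_recl big_ord0 addn0 leq_pmull //.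
by rewrite lt0n mdeg_eq0.
Qed.

Lemma power_family_out a : a \notin coideal01 -> power_family a = 0.
Proof.
rewrite inE -ltnNge => a2; apply: monomial_family_out.
apply: contra gg => /coideal_closed; apply.
by case: (a ord0) a2 => [|[|n]] // _; rewrite !mulmS addmA lem_addr.
Qed.

Lemma wsum_power (T : algOver kA) (x : T) :
  wsum power_family (1 + tconst coideal01 x * tvar T coideal01 ord0)
  = 1 + tconst Omega x * tmon T Omega g.
Proof.
rewrite (wsumD power_family_mult).
rewrite (@wsum1 _ _ _ _ _ coideal01 _ _ power_family_mult T).
rewrite -(@ttermE _ _ coideal01 x U_(ord0)%MM).
rewrite (@wsum_term _ _ _ _ _ coideal01 _ _ power_family_mult T) ?mem_U01 //.
rewrite /power_family /monomial_family mdeg1 expr1 mnm1E eqxx mulm1n.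
by rewrite tlift_mon tmonC.
Qed.

Lemma power_der_exists d : exists E : hsder kA Omega,
  hs_series E = 1 + tconst Omega (der_end d : EndA) * tmon EndA Omega g.
Proof.
have [E ED] := hs_family (hs_of_der d) power_family_mult power_family_out.
by exists E; rewrite ED -(@wsum_power EndA).
Qed.

Lemma hs_map_power_der d (E : hsder kA Omega) :
  hs_series E = 1 + tconst Omega (der_end d : EndA) * tmon EndA Omega g ->
  hs_map S E = 1 + tconst Omega (hs_nabla d) * tmon R Omega g.
Proof.
move=> ED; rewrite (hs_map_family (D := hs_of_der d) power_family_mult power_family_out).
  by rewrite hs_map_der wsum_power.
by rewrite ED -(@wsum_power EndA).
Qed.

End PowerSubst.
End HSStructures.

(** * LR-admissibility of the connection *)

Section Nabla.
Variables (k A : comPzRingType) (kA : {rmorphism k -> A}) (R : algOver kA).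
Local Notation EndA := (kEndAlg kA A^o).
Variable S : hsStructure R.

Definition square2 : coideal 2.
Proof.
refine (@Coideal 2 [pred a : 'X_{1..2} | [forall i, (a i <= 1)%N]] _ _).
  move=> a b /forallP a1 /mnm_lepP ba; apply/forallP => i.
  exact: leq_trans (ba i) (a1 i).
by exists 0%MM; apply/forallP => i; rewrite mnm0E.
Defined.

Lemma mem_square2 a : (a \in square2) = [forall i, (a i <= 1)%N].
Proof. by []. Qed.

Local Notation "'s" := (U_(ord0 : 'I_2)%MM).
Local Notation "'t" := (U_(ord_max : 'I_2)%MM).

Lemma square2_st : ('s + 't)%MM \in square2.
Proof.
rewrite mem_square2; apply/forallP => i; rewrite mnmDE !mnm1E.
by case: i => [[|[|i]] i2].
Qed.

Lemma square2_out (g : 'X_{1..2}) : g != 0%MM -> (g + g)%MM \notin square2.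
Proof.
apply: contraNN; rewrite mem_square2 => /forallP g1; apply/eqP/mnmP => i.
by have := g1 i; rewrite mnmDE mnm0E; case: (g i) => // n; rewrite addnS.
Qed.

Lemma tmon_centralM (T : pzRingType) (x y : T) p (Gamma : coideal p) a b :
  tconst Gamma x * tmon T Gamma a * (tconst Gamma y * tmon T Gamma b)
  = tconst Gamma (x * y) * tmon T Gamma (a + b)%MM.
Proof.
rewrite tmonD tconstM -!mulrA; congr (_ * _); rewrite !mulrA; congr (_ * _).
exact: tmonC.
Qed.

Lemma two_factors (T : pzRingType) (x y : T) (a b : 'X_{1..2}) :
  (1 + tconst square2 x * tmon T square2 a) * (1 + tconst square2 y * tmon T square2 b)
  = 1 + tconst square2 x * tmon T square2 a + tconst square2 y * tmon T square2 b
    + tconst square2 (x * y) * tmon T square2 (a + b)%MM.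
Proof.
by rewrite mulrDl mul1r mulrDr mulr1 tmon_centralM addrA [1 + _ + _]addrAC.
Qed.

(* Since s^2 = t^2 = 0, the group commutator of 1 + x s and 1 + y t is
   1 + (xy - yx) s t. *)
Lemma commutator_coef (T : pzRingType) (x y z : T) :
  let F w a := 1 + tconst square2 w * tmon T square2 a in
  F x 's * F y 't = F z ('s + 't)%MM * (F y 't * F x 's) <-> x * y = z + y * x.
Proof.
move=> F; rewrite /F !two_factors [('t + 's)%MM]addmC.
have out (a : 'X_{1..2}) i : (1 < a i)%N -> a \notin square2.
  by rewrite mem_square2 ltnNge; apply: contra => /forallP.
have -> : (1 + tconst square2 z * tmon T square2 ('s + 't)) *
    (1 + tconst square2 y * tmon T square2 't + tconst square2 x * tmon T square2 's
     + tconst square2 (y * x) * tmon T square2 ('s + 't))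
  = 1 + tconst square2 x * tmon T square2 's + tconst square2 y * tmon T square2 't
    + tconst square2 (z + y * x) * tmon T square2 ('s + 't).
  rewrite mulrDl mul1r 3!mulrDr mulr1 !tmon_centralM.
  rewrite [tmon _ _ ('s + 't + 't)]tmon_out; last first.
    by apply: (out _ ord_max); rewrite !mnmDE !mnm1E.
  rewrite [tmon _ _ ('s + 't + 's)]tmon_out; last first.
    by apply: (out _ ord0); rewrite !mnmDE !mnm1E.
  rewrite [tmon _ _ ('s + 't + ('s + 't))]tmon_out; last first.
    by apply: (out _ ord0); rewrite !mnmDE !mnm1E.
  rewrite !mulr0 !addr0 tconstD mulrDl -!addrA; congr (_ + _).
  by rewrite addrCA; congr (_ + _); congr (_ + _); rewrite addrC.
split=> [|-> //] /addrI /(congr1 (fun f => tcoef f ('s + 't)%MM)).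
by rewrite !tcoefCM !tmonE ?square2_st // eqxx !mulr1.
Qed.

(** Additivity comes from the product of 1 + d s and 1 + e s, A-linearity from s |-> x s, the
    Leibniz rule from the degree one part of condition (ii), and the bracket from a commutator in
    {0,1}^2. *)
Lemma hs_nabla_LR : LRadmissible (hs_nabla S).
Proof.
split.
- move=> d e; have -> : hs_nabla S (d + e)
      = hs_map S (hs_mul (hs_of_der d) (hs_of_der e)) U_(ord0)%MM.
    rewrite /hs_nabla; congr (tcoef (hs_map S _) _); apply: hsder_eqP.
    apply: tseriesP => a aD; rewrite tcoefM //.
    case: (coideal01P aD) => ->; rewrite (convsum_0, convsum_1) /=.
      by rewrite !hs_of_der_coef0 mulr1.
    rewrite !hs_of_der_coef0 mul1r mulr1 !hs_of_der_seriesE eqxx mnm1_eq0 !add0r.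
    exact: addrC.
  by rewrite hs_map_mul tcoefM ?mem_U01 // convsum_1 !hs_map_coef0 mul1r mulr1 addrC.
- move=> x d; rewrite /hs_nabla.
  have mm : mult_family (monomial_family coideal01 x id).
    exact: monomial_family_mult.
  rewrite (hs_map_family S (D := hs_of_der d) mm).
  + by rewrite wsum_scale ?mem_U01 // mdeg1 expr1.
  + by move=> a aD; apply: monomial_family_out.
  apply: tseriesP => a aD; rewrite wsum_scale //.
  case: (coideal01P aD) => ->.
    by rewrite mdeg0 expr0 rmorph1 mul1r !hs_coef0.
  rewrite mdeg1 expr1 [LHS]hs_of_der_seriesE [X in _ = _ * X]hs_of_der_seriesE.
  by rewrite eqxx mnm1_eq0 !add0r.
- move=> d x; have /(congr1 (fun f => tcoef f U_(ord0)%MM)) :=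
    hs_map_comm S (hs_of_der d) x.
  rewrite tcoefMC tcoefM ?mem_U01 // convsum_1 !tliftE !hs_appE hs_map_coef0 mulr1.
  rewrite [hs_of_der d 0%MM]hs_of_der_coef0 /= => ->; congr (_ + alg_iota R _).
  by rewrite hs_of_der_seriesE eqxx mnm1_eq0 add0r.
- move=> d e.
  have s0 : 's != 0%MM by rewrite mnm1_eq0.
  have t0 : 't != 0%MM by rewrite mnm1_eq0.
  have st0 : ('s + 't)%MM != 0%MM.
    by apply/eqP => /mnmP/(_ ord0); rewrite mnmDE !mnm1E mnm0E.
  have [D Dd] := power_der_exists s0 (square2_out s0) d.
  have [E Ee] := power_der_exists t0 (square2_out t0) e.
  have [B Bde] := power_der_exists st0 (square2_out st0) (der_bracket d e).
  have DE : hs_mul D E = hs_mul B (hs_mul E D).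
    apply: hsder_eqP; rewrite /= Dd Ee Bde.
    by apply/(@commutator_coef EndA); rewrite /= subrK.
  have := congr1 (@hs_map _ _ _ _ S _ _) DE; rewrite !hs_map_mul.
  rewrite !(hs_map_power_der S s0 (square2_out s0) Dd).
  rewrite !(hs_map_power_der S t0 (square2_out t0) Ee).
  rewrite !(hs_map_power_der S st0 (square2_out st0) Bde).
  by move=> /commutator_coef ->; rewrite addrK.
Qed.

End Nabla.

(** * Uniqueness of HS-structures *)

(** Here a is the only index of degree at least |a|, so that once lower degrees are known a single
    coefficient remains. *)
Definition box p (a : 'X_{1..p}) : coideal p :=
  @Coideal p [pred b : 'X_{1..p} | (b <= a)%MM]
    (fun b c ba cb => lepm_trans cb ba) (ex_intro _ a (lepm_refl a)).

Section HSGroup.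
Variables (k A : comPzRingType) (kA : {rmorphism k -> A}).
Local Notation EndA := (kEndAlg kA A^o).
Variables (p : nat) (Delta : coideal p).

Lemma hs_covariant (D : hsder kA Delta) : covariant EndA (hs_series D) (hs_series D).
Proof. exact/leibnizP/hs_leibniz. Qed.

Lemma hs_inv_exists (D : hsder kA Delta) :
  exists E : hsder kA Delta, hs_series E * hs_series D = 1.
Proof.
have DD := hs_covariant D; have D0 := @hs_coef0 _ _ _ _ _ D.
have [E [DE ED E0]] := tseries_inv D0.
suff EL : leibniz (E : tseries EndA Delta) by exists (HSDer E0 EL).
apply/leibnizP => x; apply: (tseries_lreg D0).
rewrite !mulrA DE mul1r (covariant_app _ _ DD) DE -mulrA DE mulr1.
by rewrite -tlift_const; congr (tlift EndA _); apply: tseriesP => a aD;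
  rewrite hs_appE tcoef1 tconstE; case: ifP.
Qed.

Lemma hs_div_exists (D E : hsder kA Delta) :
  exists G : hsder kA Delta, hs_mul G E = D.
Proof.
have [E' E'E] := hs_inv_exists E; exists (hs_mul D E'); apply: hsder_eqP.
by rewrite /= -mulrA [X in _ * X = _]E'E mulr1.
Qed.

End HSGroup.

Section Uniqueness.
Variables (k A : comPzRingType) (kA : {rmorphism k -> A}).
Variable QQ : {rmorphism rat -> k}.
Variable R : algOver kA.
Local Notation EndA := (kEndAlg kA A^o).
Variables S S' : hsStructure R.
Hypothesis SS' : forall d, hs_nabla S d = hs_nabla S' d.

Variables (p : nat) (a : 'X_{1..p}).
Hypothesis a_neq0 : a != 0%MM.
Local Notation n := (mdeg a).
Hypothesis lower : forall D : hsder kA (box a), agree n (hs_map S D) (hs_map S' D).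
Local Notation defect D := (hs_map S D a - hs_map S' D a).

Lemma box_top : a \in box a. Proof. exact: lepm_refl. Qed.

Lemma box_double : (a + a)%MM \notin box a.
Proof.
apply: contra a_neq0 => /lem_mdeg; rewrite mdegD -{3}[n]addn0 leq_add2l leqn0.
by rewrite mdeg_eq0.
Qed.

(** Beyond the two differences, f g - f' g' contains only (f - f')(g - 1) and (f' - 1)(g - g'),
    which vanish up to degree n. *)
Lemma defect_mul (D E : hsder kA (box a)) :
  defect (hs_mul D E) = defect D + defect E.
Proof.
rewrite !hs_map_mul.
have fE (f g f' g' : tseries R (box a)) : f 0%MM = 1 -> g 0%MM = 1 -> f' 0%MM = 1 ->
    agree n f f' -> agree n g g' ->
    (f * g) a - (f' * g') a = (f a - f' a) + (g a - g' a).
  move=> f0 g0 f'0 ff' gg'; rewrite -!tcoefB -tcoefD.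
  have -> : f * g - f' * g' = (f - f') + (g - g') + ((f - f') * (g - 1) + (f' - 1) * (g - g')).
    rewrite addrACA [(f - f') * _]mulrBr mulr1 [f - f' + _]addrC subrK.
    by rewrite [(f' - 1) * _]mulrBl mul1r [g - g' + _]addrC subrK mulrBl mulrBr
      addrA subrK.
  rewrite tcoefD.
  have z (h : tseries R (box a)) : h 0%MM = 1 -> (h - 1) 0%MM = 0.
    by move=> h0; rewrite tcoefB h0 tcoef1 eqxx subrr.
  have zz (h h' : tseries R (box a)) : agree n h h' -> agree n (h - h') 0.
    by move=> hh b lt_b; rewrite tcoefB hh // subrr tcoef0.
  have := agreeD (agreeSMr (z _ g0) (zz _ _ ff')) (agreeSMl (z _ f'0) (zz _ _ gg')).
  by move=> ->; rewrite ?mul0r ?mulr0 ?addr0 ?tcoef0 ?addr0.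
by apply: fE; rewrite ?hs_map_coef0 //; apply: lower.
Qed.

Definition hs_sq (D : hsder kA (box a)) := hs_mul D D.

Lemma defect_iter_sq D j : defect (iter j hs_sq D) = defect D *+ 2 ^ j.
Proof.
elim: j => [|j IHj]; first by rewrite expn0 mulr1n.
by rewrite iterS defect_mul IHj expnS mul2n -addnn mulrnDr.
Qed.

Let scale2 := monomial_family (box a) (2%:R : A) id.

Lemma scale2_mult : mult_family scale2.
Proof. exact: monomial_family_mult. Qed.

Lemma scale2_out b : b \notin box a -> scale2 b = 0.
Proof. by move=> bD; apply: monomial_family_out. Qed.

Lemma wsum_scale2 (T : algOver kA) (r : tseries T (box a)) b :
  wsum scale2 r b = r b *+ 2 ^ mdeg b.
Proof.
have [bD|bD] := boolP (b \in box a); last by rewrite !tcoef_out // mul0rn.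
by rewrite wsum_scale // -natrX rmorph_nat mulr_natl.
Qed.

Lemma defect_scale2 (D E : hsder kA (box a)) :
  hs_series E = wsum (R := EndA) scale2 D -> defect E = defect D *+ 2 ^ n.
Proof.
move=> ED; rewrite !(hs_map_family _ scale2_mult scale2_out ED) !wsum_scale2.
by rewrite mulrnBl.
Qed.

(** For D = 1 + u with u of order j, squaring doubles u modulo u^2, which has order at least j +
    1. *)
Lemma agree_iter_sq j i (D : hsder kA (box a)) : (0 < j)%N ->
  agree j (hs_series D) 1 ->
  agree j.+1 (hs_series (iter i hs_sq D)) (1 + (hs_series D - 1) *+ 2 ^ i).
Proof.
move=> j0 D1; elim: i => [|i IHi].
  by rewrite expn0 mulr1n addrC subrK.
apply: agree_trans (agreeM IHi IHi) _.
set u := _ *+ 2 ^ i.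
have u0 : u 0%MM = 0 by rewrite tcoefMn tcoefB hs_coef0 tcoef1 eqxx subrr mul0rn.
have uu : agree j.+1 (u * u) 0.
  rewrite -(mulr0 u); apply: agreeSMl => // b lt_b.
  by rewrite tcoefMn tcoefB D1 // subrr mul0rn tcoef0.
rewrite mulrDl mul1r mulrDr mulr1 addrA expnS mul2n -addnn mulrnDr addrA.
rewrite -[X in agree _ _ X]addr0; exact: agreeD.
Qed.

Lemma agree_scale2 j (D E : hsder kA (box a)) :
  hs_series E = wsum (R := EndA) scale2 D -> agree j (hs_series D) 1 ->
  agree j.+1 (hs_series E) (1 + (hs_series D - 1) *+ 2 ^ j).
Proof.
move=> -> D1 b; rewrite ltnS (@wsum_scale2 EndA) tcoefD tcoefMn tcoefB.
have [-> _|b0] := eqVneq b 0%MM.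
  by rewrite hs_coef0 tcoef1 eqxx mdeg0 subrr mul0rn addr0.
rewrite leq_eqVlt => /orP[/eqP->|lt_b].
  by rewrite tcoef1 (negbTE b0) subr0 add0r.
by rewrite D1 // tcoef1 (negbTE b0) subr0 !mul0rn addr0.
Qed.

(* The Adams operation scale2 acts on the degree j part of D as the 2^j-th
   power does, so their quotient has a higher order; on the defect, which lives in
   degree n > j, they act as 2^n and 2^j. *)
Lemma defect_order j (D : hsder kA (box a)) : (0 < j <= n)%N ->
  agree j (hs_series D) 1 -> defect D = 0.
Proof.
have [i] := ubnP (n - j); elim: i j D => // i IHi j D lt_i /andP[j0 le_jn] D1.
have [jn|lt_jn] := eqVneq j n; last first.
  have {}lt_jn : (j < n)%N by rewrite ltn_neqAle lt_jn.
  have [E ED] := hs_family D scale2_mult scale2_out.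
  have [G GE] := hs_div_exists E (iter j hs_sq D).
  have G0 : defect G = 0.
    apply: (IHi j.+1); first by rewrite -ltnS (leq_trans _ lt_i) // ltnS subnS prednK ?subn_gt0.
      by rewrite lt_jn.
    have GE1 : agree j.+1 (hs_series G * hs_series (iter j hs_sq D))
        (1 * hs_series (iter j hs_sq D)).
      have -> : hs_series G * hs_series (iter j hs_sq D) = hs_series E by rewrite -GE.
      rewrite mul1r; apply: agree_trans (agree_scale2 ED D1) _.
      by apply: agree_sym; apply: agree_iter_sq.
    have [I [DI _ _]] := tseries_inv (@hs_coef0 _ _ _ _ _ (iter j hs_sq D)).
    have := agreeMr I GE1; by rewrite -!mulrA DI !mulr1.
  (* Since G has no defect, 2^n - 2^j times the defect of D is zero, and j < n. *)
  have := defect_mul G (iter j hs_sq D); rewrite GE G0 add0r.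
  rewrite (defect_scale2 ED) defect_iter_sq => /eqP.
  rewrite -subr_eq0 -mulrnBr ?leq_pexp2l ?(ltnW lt_jn) //.
  have : (0 < 2 ^ n - 2 ^ j)%N by rewrite subn_gt0 ltn_exp2l.
  case: (_ - _)%N => // l _ /eqP.
  exact: (nat_torsion_free (@alg_div_nat _ _ _ R QQ)).
(* Remaining case j = n: only the coefficients at 0 and a of D survive. *)
rewrite jn in D1 => {j0 le_jn lt_i IHi}.
have Dab b : b \in box a -> b != a -> (mdeg b < n)%N.
  move=> ba bna; rewrite ltn_neqAle lem_mdeg // andbT.
  apply: contra bna => /eqP e; apply/eqP.
  have /eqP : mdeg (a - b)%MM = 0%N.
    by apply: (@addIn (mdeg b)); rewrite -mdegD submK.
  by rewrite mdeg_eq0 => /eqP ab0; rewrite -(submK ba) ab0 add0m.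
have Dder : `[< forall x y : A, (hs_series D a : kEnd kA A^o) (x * y)
    = x * ((hs_series D a : kEnd kA A^o) y : A)
      + ((hs_series D a : kEnd kA A^o) x : A) * y >].
  apply/asboolP => x y; rewrite (@hs_leibniz _ _ _ _ _ D _ box_top).
  pose F b c := (hs_series D b x : A) * (hs_series D c y : A).
  (* In the Leibniz rule for D_a only b = 0 and c = 0 contribute, since D_b = 0 for 0 < |b| < n. *)
  transitivity (convsum (fun b c => (if b == 0%MM then F b c else 0)
      + (if c == 0%MM then F b c else 0)) a).
    apply: eq_convsum => b c aE; rewrite /F.
    have [b0|b0] := eqVneq b 0%MM; have [c0|c0] := eqVneq c 0%MM.
    - by case/eqP: a_neq0; rewrite aE b0 c0 addm0.
    - by rewrite addr0.
    - by rewrite add0r.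
    have lt_b : (mdeg b < n)%N by rewrite [n](congr1 _ aE); apply: mdeg_add_neq0 c0.
    by rewrite D1 // tcoef1 (negbTE b0) addr0 [(0 : kEnd kA A^o) x]/= mul0r.
  rewrite convsumD convsum0l => [|b c /negbTE -> //].
  rewrite convsum0r => [|b c /negbTE -> //].
  by rewrite !eqxx /F hs_coef0.
have DE : hs_series D = 1 + tconst (box a) (der_end (Der Dder) : EndA) * tmon EndA (box a) a.
  apply: tseriesP => b bD; rewrite tcoefD tcoef1 tcoefCM tmonE //.
  have [->|ba] := eqVneq b a; first by rewrite (negbTE a_neq0) add0r mulr1.
  by rewrite mulr0 addr0 -(tcoef1 EndA (box a)); apply: D1; apply: Dab.
by rewrite !(hs_map_power_der _ a_neq0 box_double DE) SS' subrr.
Qed.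

End Uniqueness.

Section StructureEquality.
Variables (k A : comPzRingType) (kA : {rmorphism k -> A}).
Variable QQ : {rmorphism rat -> k}.
Variable R : algOver kA.

(** Induction on the degree for all co-ideals at once, since the step passes from Delta to the
    co-ideal of the b <= a. *)
Lemma hs_map_uniq (S S' : hsStructure R) :
  (forall d, hs_nabla S d = hs_nabla S' d) ->
  forall p (Delta : coideal p) (D : hsder kA Delta), hs_map S D = hs_map S' D.
Proof.
move=> SS' p Delta D; apply: agreeP => n.
elim: n Delta D => // n IHn Delta D a; rewrite ltnS => le_an.
have [aD|aD] := boolP (a \in Delta); last by rewrite !tcoef_out.
have [->|a0] := eqVneq a 0%MM; first by rewrite !hs_map_coef0.
(* The substitution s |-> s, that is, truncation from Delta to [box a]; it keeps the coefficient at
   a. *)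
pose m := monomial_family (box a) (1 : A) id.
have mm : mult_family m by exact: monomial_family_mult.
have mo b : b \notin Delta -> m b = 0.
  by move=> bD; apply: monomial_family_out; apply: contra bD; apply: coideal_closed.
have [E ED] := hs_family D mm mo.
have restr (T : hsStructure R) : hs_map T D a = hs_map T E a.
  rewrite (hs_map_family T mm mo ED) wsum_scale ?expr1n ?rmorph1 ?mul1r //.
  exact: box_top.
apply/eqP; rewrite -subr_eq0 !restr; apply/eqP.
(* The descent starts at j = 1: every D agrees with 1 in degree 0. *)
apply: (@defect_order _ _ _ QQ _ _ _ SS' _ _ a0 _ 1).
- by move=> G; apply: agreeW (IHn _ G).
- by rewrite andTb lt0n mdeg_eq0.
- by apply: agree1; rewrite hs_coef0 tcoef1 eqxx.
Qed.

Lemma hsStructure_eq (S S' : hsStructure R) :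
  (forall d, hs_nabla S d = hs_nabla S' d) -> S = S'.
Proof.
move=> /hs_map_uniq; case: S S' => [m a b c d] [m' a' b' c' d'] /= mm'.
have E : m = m'.
  apply: functional_extensionality_dep => p.
  by apply: functional_extensionality_dep => Delta; apply/funext => D.
case: m' / E a' b' c' d' {mm'} => a' b' c' d'.
by congr HSStructure; apply: Prop_irrelevance.
Qed.

Lemma hs_nabla_conn (nabla : der kA -> R) (nabla_LR : LRadmissible nabla) d :
  hs_nabla (conn_hs_structure QQ nabla_LR) d = nabla d.
Proof.
rewrite /hs_nabla /= conn_hs_map_der tcoefD tcoef1 mnm1_eq0 add0r tcoefCM.
by rewrite tmonE ?mem_U01 // eqxx mulr1.
Qed.

End StructureEquality.

(** * The isomorphism of categories *)

Section Commutation.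
Variables (k A : comPzRingType) (kA : {rmorphism k -> A}) (sd : side).
Variable QQ : {rmorphism rat -> k}.
Variables (E F : lmodType A) (f : E -> F).
Hypothesis f_lin : linear f.

Definition intertwines (u : sideAlg kA sd E) (v : sideAlg kA sd F) :=
  forall x, f (sideEnd u x) = sideEnd v (f x).

Let fD x y : f (x + y) = f x + f y.
Proof. by rewrite -{1}[x]scale1r f_lin scale1r. Qed.

Let f0 : f 0 = 0.
Proof. by apply: (addrI (f 0)); rewrite -fD !addr0. Qed.

Lemma intertwinesD u u' v v' :
  intertwines u v -> intertwines u' v' -> intertwines (u + u') (v + v').
Proof.
rewrite /intertwines => uv uv' x; move: (uv x) (uv' x); clear uv uv'.
by case: sd u u' v v' => u u' v v' /= uv uv'; rewrite fD uv uv'.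
Qed.

Lemma intertwines0 : intertwines 0 0.
Proof. by rewrite /intertwines; case: sd. Qed.

Lemma intertwines1 : intertwines 1 1.
Proof. by rewrite /intertwines; case: sd. Qed.

Lemma intertwinesM u u' v v' :
  intertwines u v -> intertwines u' v' -> intertwines (u * u') (v * v').
Proof.
rewrite /intertwines; case: sd u u' v v' => u u' v v' /= uv uv' x.
  by rewrite uv uv'.
by rewrite uv' uv.
Qed.

Lemma intertwines_iota c : intertwines (alg_iota _ c) (alg_iota _ c).
Proof.
have fZ x : f (c *: x) = c *: f x by rewrite -[c *: x]addr0 f_lin f0 addr0.
by rewrite /intertwines; case: sd => x /=; apply: fZ.
Qed.

Lemma intertwines_convsum p U V (a : 'X_{1..p}) :
  (forall b c, a = (b + c)%MM -> intertwines (U b c) (V b c)) ->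
  intertwines (convsum U a) (convsum V a).
Proof.
move=> UV; rewrite /convsum; elim/big_rec2: _ => [|bc v u /eqP /UV].
  exact: intertwines0.
exact: intertwinesD.
Qed.

(** Division by n + 1 is multiplication by a scalar of A, which f respects. *)
Lemma intertwinesMn u v n :
  intertwines (u *+ n.+1) (v *+ n.+1) -> intertwines u v.
Proof.
have [q qE] : exists q : A, forall (G : lmodType A) (w : sideAlg kA sd G),
    alg_iota _ q * (w *+ n.+1) = w.
  exists (kA (QQ (n.+1%:R^-1))) => G w.
  rewrite mulrnAr -mulrnAl -!rmorphMn -mulr_natr mulVf.
    by rewrite !rmorph1 mul1r.
  by rewrite Num.Theory.pnatr_eq0.
move=> uv; rewrite -[u]qE -[v]qE; apply: intertwinesM uv.
exact: intertwines_iota.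
Qed.

(** The equation E(P) = P nabla(e) computes P_a from lower coefficients and the nabla(e_c), and e
    depends on D alone; so f commutes with every coefficient once it commutes with the
    connections. *)
Lemma conn_hs_map_intertwines (nE : der kA -> sideAlg kA sd E)
    (nF : der kA -> sideAlg kA sd F) (LE : LRadmissible nE) (LF : LRadmissible nF)
    p (Delta : coideal p) (D : hsder kA Delta) a :
  (forall d, intertwines (nE d) (nF d)) ->
  intertwines (conn_hs_map QQ LE D a) (conn_hs_map QQ LF D a).
Proof.
move=> nEF; have [e [e0 D0 P0 eD eP]] := conn_hs_mapP QQ LE D.
have [h [_ _ Q0 hD hQ]] := conn_hs_mapP QQ LF D.
have he : h = e.
  by apply: dser_inj; apply: (tseries_lreg D0); rewrite -eD -hD.
rewrite {}he in hQ hD *.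
move: (conn_hs_map QQ LE D) (conn_hs_map QQ LF D) P0 Q0 eP hQ => P Q P0 Q0 eP hQ.
have [n] := ubnP (mdeg a); elim: n a => // n IHn a lt_a.
have [aD|aD] := boolP (a \in Delta); last first.
  by rewrite !tcoef_out //; apply: intertwines0.
have [->|a0] := eqVneq a 0%MM; first by rewrite P0 Q0; apply: intertwines1.
suff: intertwines (P a *+ mdeg a) (Q a *+ mdeg a).
  by move: a0; rewrite -mdeg_eq0; case: (mdeg a) => // l _; apply: intertwinesMn.
rewrite -!eulerE eP hQ !tcoefM //; apply: intertwines_convsum => b c aE.
rewrite (nserE LE) (nserE LF).
have [->|c0] := eqVneq c 0%MM.
  by rewrite e0 (nabla0 LE) (nabla0 LF) !mulr0; apply: intertwines0.
apply: intertwinesM; last exact: nEF.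
by apply: IHn; apply: mdeg_add_neq0 c0; rewrite -aE.
Qed.

End Commutation.

(* Morphisms are compared through their underlying maps, packed with their type:
   F X = X is only a propositional equality. *)
Lemma functor_eq_id (C : category) (U : forall X Y : C, Defs.hom X Y -> {T : Type & T})
    (F : functor C C) :
  (forall X Y (f g : Defs.hom X Y), U X Y f = U X Y g -> f = g) ->
  (forall X, F X = X) ->
  (forall X Y (f : Defs.hom X Y), U (F X) (F Y) (fmap F f) = U X Y f) ->
  F = functor_id C.
Proof.
case: F => o m m1 mM /= U_inj oE mE.
have {}oE : o = id by apply/funext.
subst o; have E : m = fun _ _ f => f.
  apply: functional_extensionality_dep => X.
  apply: functional_extensionality_dep => Y.
  by apply/funext => f; apply: U_inj; apply: mE.
subst m; rewrite /functor_id; congr Functor; exact: Prop_irrelevance.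
Qed.

Lemma packed_inj (T : Type) (x y : T) :
  existT (fun T : Type => T) T x = existT (fun T : Type => T) T y -> x = y.
Proof.
move=> e; have := projT2_eq e.
by rewrite (Prop_irrelevance (projT1_eq e) erefl).
Qed.

Section Isomorphism.
Variables (k A : comPzRingType) (kA : {rmorphism k -> A}) (sd : side).
Variable QQ : {rmorphism rat -> k}.

Definition conn_to_hs_obj (N : connModule kA sd) : hsModule kA sd :=
  HSModule (conn_hs_structure QQ (conn_LR N)).

Fact conn_to_hs_comm (M N : connModule kA sd) (f : connMap M N)
    p (Delta : coideal p) (a : 'X_{1..p}) (D : hsder kA Delta) (x : M) :
  a \in Delta ->
  f (sideEnd (hs_map (hsm_str (conn_to_hs_obj M)) D a) x)
  = sideEnd (hs_map (hsm_str (conn_to_hs_obj N)) D a) (f x).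
Proof.
move=> _; apply: conn_hs_map_intertwines; first exact: connmap_linear.
by move=> d y; apply: connmap_comm.
Qed.

Definition conn_to_hs_map (M N : connModule kA sd) (f : connMap M N) :
    hsMap (conn_to_hs_obj M) (conn_to_hs_obj N) :=
  @HSMap _ _ _ _ (conn_to_hs_obj M) (conn_to_hs_obj N) f
    (@connmap_linear _ _ _ _ _ _ f) (conn_to_hs_comm f).

Definition conn_to_hs : functor (connModuleCategory kA sd) (hsModuleCategory kA sd).
Proof.
refine (@Functor (connModuleCategory kA sd) (hsModuleCategory kA sd)
  conn_to_hs_obj conn_to_hs_map _ _).
- by move=> M; apply: hsmap_eqP.
- by move=> M N P g f; apply: hsmap_eqP.
Defined.

Definition module_nabla (M : hsModule kA sd) : der kA -> sideAlg kA sd M :=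
  hs_nabla (hsm_str M).

Lemma module_nabla_LR M : LRadmissible (module_nabla M).
Proof. exact: hs_nabla_LR. Qed.

Lemma module_nabla_comm (M N : hsModule kA sd) (f : hsMap M N) d (x : M) :
  f (sideEnd (module_nabla M d) x) = sideEnd (module_nabla N d) (f x).
Proof. by apply: hsmap_comm; apply: mem_U01. Qed.

Lemma hs_to_conn_iso :
  isomorphism_of_categories (hs_to_conn module_nabla_LR module_nabla_comm).
Proof.
exists conn_to_hs; split.
- apply: (@functor_eq_id (hsModuleCategory kA sd)
    (fun M N f => existT (fun T : Type => T) (M -> N) (hsmap_fun f))) => //.
    by move=> M N f g fg; apply: hsmap_eqP => x; rewrite (packed_inj fg).
  move=> [E S] /=; congr HSModule; apply: (hsStructure_eq QQ) => d.
  exact: hs_nabla_conn.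
- apply: (@functor_eq_id (connModuleCategory kA sd)
    (fun M N f => existT (fun T : Type => T) (M -> N) (connmap_fun f))) => //.
    by move=> M N f g fg; apply: connmap_eqP => x; rewrite (packed_inj fg).
  move=> [E n L] /=; rewrite /hs_to_conn_obj /=.
  have nE : module_nabla (conn_to_hs_obj (ConnModule L)) = n.
    by apply/funext => d; apply: hs_nabla_conn.
  (* The admissibility proof depends on the map being rewritten, so it is abstracted first. *)
  move: (module_nabla_LR _); rewrite nE => L'.
  by congr ConnModule; apply: Prop_irrelevance.
Qed.

End Isomorphism.

Theorem corollary2p2p8 (k A : comPzRingType) (kA : {rmorphism k -> A})
    (QQ_in_k : {rmorphism rat -> k}) (QQ_in_k_inj : injective QQ_in_k)
    (sd : side) :
  exists (nabla : forall M : hsModule kA sd, der kA -> sideAlg kA sd M)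
         (nabla_LR : forall M : hsModule kA sd, LRadmissible (nabla M))
         (nabla_comm : forall (M N : hsModule kA sd) (f : hsMap M N)
            (d : der kA) (x : M),
            f (sideEnd (nabla M d) x) = sideEnd (nabla N d) (f x)),
    (forall (M : hsModule kA sd) (d : der kA),
       hs_map (hsm_str M) (hs_of_der d)
       = 1 + tconst coideal01 (nabla M d) * tvar (sideAlg kA sd M) coideal01 ord0)
    /\ isomorphism_of_categories (hs_to_conn nabla_LR nabla_comm).
Proof.
exists (@module_nabla k A kA sd), (@module_nabla_LR k A kA sd),
  (@module_nabla_comm k A kA sd); split; last exact: hs_to_conn_iso.
by move=> M d; apply: hs_map_der.
Qed.
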